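(* Let $n\ge 1$ be an integer and let $A={}^t(\alpha_1,\dots,\alpha_n)$ be an $n\times 1$ real matrix such that $1,\alpha_1,\dots,\alpha_n$ are linearly independent over $\mathbf{Q}$. For every real number $v\ge\hat{\omega}(A)$, the set $$\mathcal{B}_v=\{\beta\in\mathbf{R}^n:\ \omega(A,\beta)\ge v\}$$ has Hausdorff dimension $\delta(v)=1/v$.
   Context: For $\theta\in\mathbf{R}^n$, $|\theta|$ denotes the supremum norm of $\theta$ and $\|\theta\|=\min_{x\in\mathbf{Z}^n}|\theta-x|$ its distance to the nearest integer point. Let $A\in\mathbf{R}^n$ be a column vector ($n\times 1$ matrix). Inhomogeneous exponent: for $\beta\in\mathbf{R}^n$, $\omega(A,\beta)$ is the supremum (possibly infinite) of the real numbers $\omega$ for which there exist infinitely many (nonzero) integers $q\in\mathbf{Z}$ such that $\|qA-\beta\|\le |q|^{-\omega}$. Uniform homogeneous exponent: $\hat{\omega}(A)$ is the supremum (possibly infinite) of the real numbers $\omega$ such that for every sufficiently large positive real number $Q$ there exists a nonzero integer $q\in\mathbf{Z}$ with $|q|\le Q$ and $\|qA\|\le Q^{-\omega}$. $\delta(v)$ denotes the Hausdorff dimension of $\mathcal{B}_v\subseteq\mathbf{R}^n$. *)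

(* Defs.v *)
From mathcomp Require Export all_boot all_order all_algebra.
From mathcomp Require Export all_classical all_reals all_analysis.
From mathcomp Require Import zify lra.

Set Implicit Arguments.
Unset Strict Implicit.
Unset Printing Implicit Defensive.

Import Order.TTheory GRing.Theory Num.Theory.
Import numFieldNormedType.Exports.

Local Open Scope classical_set_scope.
Local Open Scope ring_scope.

Section Hausdorff.
Context {R : realType} {V : normedModType R}.
Implicit Types (U E : set V) (s e : R).

(* Adjoining 0 gives the empty set diameter 0 instead of -oo. *)
Definition diam U : \bar R :=
  ereal_sup (0%E |` [set (`|xy.1 - xy.2|)%:E | xy in U `*` U]).

(* diam(U)^s, with the usual conventions for s = 0: the empty set contributes 0
   and a singleton contributes 0^0 = 1, so that H^0 is the counting measure. *)
Definition diam_pow s U : \bar R :=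
  if U == set0 then 0%E else poweR (diam U) s.

Definition hausdorff_premeasure s e E : \bar R :=
  ereal_inf [set (\sum_(0 <= i <oo) diam_pow s (F i))%E |
    F in [set F : (set V)^nat |
      E `<=` \bigcup_i F i /\ forall i, (diam (F i) <= e%:E)%E]].

(* The supremum over e > 0 is the limit as e tends to 0, since the
   premeasures are nonincreasing in e. *)
Definition hausdorff_measure s E : \bar R :=
  ereal_sup [set hausdorff_premeasure s e E | e in [set e : R | 0 < e]].

Definition hausdorff_dim E : \bar R :=
  ereal_inf [set s%:E | s in [set s : R | 0 <= s /\ hausdorff_measure s E = 0%E]].

End Hausdorff.

Section Exponents.
Context {R : realType} {n : nat}.
Implicit Types (A beta theta : 'cV[R]_n) (v : R).

(* The norm on column vectors is the library's sup norm. The infimum is a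
   minimum, see dist_intP. *)
Definition dist_int theta : R :=
  inf [set `|theta - map_mx intr x| | x in [set: 'cV[int]_n]].

Definition inhom_exponent A beta : \bar R :=
  ereal_sup [set w%:E | w in [set w : R |
    infinite_set [set q : int | q != 0 /\
      dist_int (q%:~R *: A - beta) <= `|q%:~R : R| `^ (- w)]]].

Definition unif_exponent A : \bar R :=
  ereal_sup [set w%:E | w in [set w : R |
    \forall Q \near +oo, exists q : int,
      [/\ q != 0, `|q%:~R| <= (Q : R) & dist_int (q%:~R *: A) <= Q `^ (- w)]]].

Definition rat_independent_with1 A : Prop :=
  forall (c0 : rat) (c : 'I_n -> rat),
    ratr c0 + \sum_(i < n) ratr (c i) * A i ord0 = 0 ->
    c0 = 0 /\ forall i, c i = 0.

Definition approx_set A v : set 'cV[R]_n :=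
  [set beta | (v%:E <= inhom_exponent A beta)%E].

End Exponents.

Lemma mx_norm_lub {R : realType} {m n : nat} (M : 'M[R]_(m, n)) (a : R) :
  0 <= a -> (`|M| <= a) <-> (forall i j, `|M i j| <= a).
Proof.
move=> a0; rewrite /Num.norm /= mx_normrE; split.
  move=> /bigmax_leP[_ h] i j; exact: (h (i, j)).
by move=> h; apply/bigmax_leP; split => // -[i j] _; exact: h.
Qed.

Lemma dist_intP {R : realType} {n : nat} (theta : 'cV[R]_n) :
  exists x : 'cV[int]_n, dist_int theta = `|theta - map_mx intr x|
    /\ forall y : 'cV[int]_n,
         `|theta - map_mx intr x| <= `|theta - map_mx intr y|.
Proof.
pose x : 'cV[int]_n := \col_i Num.floor (theta i ord0 + 2^-1).
have xmin y : `|theta - map_mx intr x| <= `|theta - map_mx intr y|.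
  apply/mx_norm_lub => // i j; rewrite (ord1 j).
  have := lexx `|theta - map_mx intr y|.
  move/(mx_norm_lub _ (normr_ge0 _)) => /(_ i ord0); apply: le_trans.
  rewrite !mxE; set t := theta i ord0; set k := Num.floor _; set z := y i ord0.
  have k1 : k%:~R <= t + 2^-1 :> R by exact: Num.Theory.floor_le.
  have k2 : t + 2^-1 < k%:~R + 1 :> R.
    by rewrite -[1]/(1%:~R) -intrD; exact: floorD1_gt.
  have [->//|zk] := eqVneq z k.
  have : (z + 1 <= k) || (k + 1 <= z) by lia.
  case/orP; rewrite -(ler_int R) intrD mulr1z => zk';
    case: (ler0P (t - z%:~R)) => h1; case: (ler0P (t - k%:~R)) => h2; lra.
exists x; split=> //; apply/eqP; rewrite eq_le; apply/andP; split.
  apply: ge_inf; last by exists x.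
  by exists 0 => _ [y _ <-].
apply: lb_le_inf; first by exists `|theta - map_mx intr x|, x.
by move=> _ [y _ <-].
Qed.

(* Main.v *)
Require Import Defs.
From mathcomp Require Import zify lra ring finmap.

Import Order.TTheory GRing.Theory Num.Theory.
Import numFieldNormedType.Exports.
Local Open Scope classical_set_scope.
Local Open Scope ring_scope.

(** The set in question is, up to an arbitrarily small change of the exponent
    [v], the set of points that lie modulo 1 in infinitely many of the balls of
    center [q A] and radius [|q| ^ (- v)].

    Upper bound. The radii to the power [s] have a finite sum as soon as
    [s > 1 / v], so a Borel--Cantelli covering shows that the [s]-dimensional
    Hausdorff measure vanishes ([hausdorff_measure_limsup_eq0]). Only countably
    many integer translations have to be taken into account
    ([approx_set_cover]).

    Lower bound. Let [s < 1 / v]. The points [y(t_0) + y(t_1) + ...] form a Cantor set,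
    where [y(t)] is the residue of [t A] modulo 1 closest
    to 0 and [t_j] runs over the return times [0 < t < Q_j] for which [y(t)] has
    norm at most [r_j]; the next radius [r_(j+1)] is about [Q_j ^ (- v)]. A
    partial sum is a multiple [q A] modulo 1 with [q <= 2 Q_j], and the remaining
    terms are bounded by a multiple of [r_(j+1)], so all points of the Cantor set
    are approximated to the exponent [v] ([sum_set_approx]). Its Hausdorff measure
    is positive by the mass distribution principle
    ([hausdorff_measure_sum_set_neq0]), provided that the return times are
    regularly distributed: among them, the proportion of those with [y(t)] in a
    given ball of radius [u >= r_(j+1)] must be [O((u / r_j) ^ s)]
    ([steps_regular]).

    The regularity is where the hypothesis on the uniform exponent enters. For
    [w > v] there are arbitrarily large [X] such that no multiple of [A] of index
    up to [X] comes within [rho = X ^ (- w)] of an integer point. Let [Q] be the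
    first index of a multiple that does. Then [Q > X], and modulo 1 the orbit
    segment of length [Q] follows, up to [rho], a cyclic group of order [Q]
    generated by a rational point, whose nonzero elements have norm at least
    [rho / 2]. Let [N u] be the number of elements of norm at most [u] in this
    group. Counting the combinations [M a + b] of elements [a] and [b] of a ball
    shows that [log N] is, up to constants, a convex function of [log u]
    ([ball_card_logconvex]), so [N] lies below the chord between
    [N (rho / 2) = 1] and [N r], which is of order [Q] by the pigeonhole
    principle; for [rho >= Q ^ (- w)] and large [Q] the slope of this chord
    exceeds any number smaller than [1 / w] ([logconvex_chord]). *)

(** * Real powers *)

Lemma powR_large {R : realType} (a K : R) : 0 < a ->
  exists2 X : R, 0 < X & forall x, X <= x -> K <= x `^ a.
Proof.
move=> a0; pose M := Num.max K 1; have M1 : 1 <= M by rewrite le_max lexx orbT.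
have M0 : 0 < M by lra.
exists (M `^ a^-1); first exact: powR_gt0.
move=> x Xx; apply: (@le_trans _ _ M); first by rewrite le_max lexx.
have {1}-> : M = (M `^ a^-1) `^ a by rewrite -powRrM mulVf ?gt_eqF // powRr1 // ltW.
by rewrite ge0_ler_powR ?nnegrE ?powR_ge0 ?(ltW a0) //; apply: le_trans Xx; exact: powR_ge0.
Qed.

Lemma powR_ge1 {R : realType} (x a : R) : 1 <= x -> 0 <= a -> 1 <= x `^ a.
Proof.
move=> x1 a0; have : 1 `^ a <= x `^ a by rewrite ge0_ler_powR ?nnegrE //; lra.
by rewrite powR1.
Qed.

Lemma powR_le1 {R : realType} (x a : R) : 0 <= x -> x <= 1 -> 0 <= a -> x `^ a <= 1.
Proof.
move=> x0 x1 a0; have : x `^ a <= 1 `^ a by rewrite ge0_ler_powR ?nnegrE //; lra.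
by rewrite powR1.
Qed.

(** Discrete primitive of [x ^ (- 1 - b)]. With [y = i / (i + 1)] it reads
    [y ^ (- b) >= 1 + b / (i + 1)], which is [ln y <= y - 1] followed by
    [expR x >= 1 + x]. It gives an explicit tail of a convergent power series. *)
Lemma powR_telescope {R : realType} (b : R) (i : nat) : 0 < b -> (0 < i)%N ->
  b * i.+1%:R `^ (- (1 + b)) <= i%:R `^ (- b) - i.+1%:R `^ (- b).
Proof.
move=> b0 i0; have i0' : 0 < i%:R :> R by rewrite ltr0n.
have i1 : 0 < i.+1%:R :> R by [].
pose y : R := i%:R / i.+1%:R.
have y0 : 0 < y by rewrite divr_gt0.
have yE : y = 1 + - i.+1%:R^-1.
  by rewrite /y -[in LHS](addrK 1 i%:R) natr1 mulrBl divff ?gt_eqF // mul1r.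
have : 1 + b / i.+1%:R <= y `^ (- b).
  rewrite /powR gt_eqF //; apply: le_trans (expR_ge1Dx _).
  have : ln y <= - i.+1%:R^-1.
    rewrite yE; apply: le_ln1Dx; rewrite ltrN2 invf_lt1 // ltr1n.
    by rewrite ltnS.
  by move=> h; rewrite lerD2l mulNr -mulrN ler_wpM2l ?(ltW b0) // lerNr.
have -> : i%:R = i.+1%:R * y by rewrite /y mulrC divfK ?gt_eqF.
rewrite powRM ?(ltW y0) // opprD powRD; last by apply/implyP => _; rewrite gt_eqF.
rewrite powR_inv1 // => h.
have := ler_wpM2l (powR_ge0 i.+1%:R (- b)) h.
by rewrite mulrDr mulr1 lerBrDl [b * (_ * _)]mulrA [b / _ * _]mulrC.
Qed.

(** * Distance to the integer lattice *)

Section TorusNorm.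
Context {R : realType} {n : nat}.
Implicit Types (theta phi : 'cV[R]_n) (x : 'cV[int]_n).

Definition int_vec x : 'cV[R]_n := map_mx intr x.

Lemma int_vecD x y : int_vec (x + y) = int_vec x + int_vec y.
Proof. by apply/matrixP => i j; rewrite !mxE intrD. Qed.

Lemma int_vecN x : int_vec (- x) = - int_vec x.
Proof. by apply/matrixP => i j; rewrite !mxE mulrNz. Qed.

Lemma int_vecZ (k : nat) x : int_vec (x *+ k) = k%:R *: int_vec x.
Proof.
rewrite scaler_nat; elim: k => [|k ih]; last by rewrite !mulrS int_vecD ih.
by apply/matrixP => i j; rewrite !mxE.
Qed.

Lemma nearest_exists theta : exists x, dist_int theta = `|theta - int_vec x|.
Proof. by have [x [h _]] := dist_intP theta; exists x. Qed.

Definition nearest theta : 'cV[int]_n := sval (cid (nearest_exists theta)).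

(** The representative of [theta] modulo the integer lattice closest to 0. *)
Definition residue theta : 'cV[R]_n := theta - int_vec (nearest theta).

Lemma norm_residue theta : `|residue theta| = dist_int theta.
Proof. by rewrite /residue /nearest; case: cid => x /= ->. Qed.

Lemma dist_int_ge0 theta : 0 <= dist_int theta.
Proof. by rewrite -norm_residue. Qed.

Lemma dist_int_le theta x : dist_int theta <= `|theta - int_vec x|.
Proof. by have [y [-> h]] := dist_intP theta; exact: h. Qed.

Lemma dist_int_le_norm theta : dist_int theta <= `|theta|.
Proof.
suff -> : `|theta| = `|theta - int_vec 0| by exact: dist_int_le.
by congr `| _ |; apply/matrixP => i j; rewrite !mxE subr0.
Qed.

Lemma dist_int_shift theta x : dist_int (theta + int_vec x) = dist_int theta.
Proof.
have shift_le u y : dist_int (u + int_vec y) <= dist_int u.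
  rewrite -(norm_residue u) /residue.
  have -> : u - int_vec (nearest u) = u + int_vec y - int_vec (nearest u + y).
    by rewrite int_vecD opprD addrACA subrr addr0.
  exact: dist_int_le.
apply/eqP; rewrite eq_le shift_le /=.
by have := shift_le (theta + int_vec x) (- x); rewrite int_vecN addrK.
Qed.

Lemma dist_intB_le theta phi :
  dist_int (theta - phi) <= dist_int theta + dist_int phi.
Proof.
rewrite -(dist_int_shift _ (nearest phi - nearest theta)).
have -> : theta - phi + int_vec (nearest phi - nearest theta) =
          residue theta - residue phi.
  by apply/matrixP => i j; rewrite !mxE intrB; ring.
apply: le_trans (dist_int_le_norm _) _.
by apply: le_trans (ler_normB _ _) _; rewrite !norm_residue.
Qed.

Lemma dist_intN theta : dist_int (- theta) = dist_int theta.
Proof.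
have le0 (u : 'cV[R]_n) : dist_int (- u) <= dist_int u.
  have := dist_intB_le 0 u; rewrite sub0r => /le_trans; apply.
  by rewrite gerDr -(normr0 'cV[R]_n) dist_int_le_norm.
by apply/eqP; rewrite eq_le le0 -{1}(opprK theta) le0.
Qed.

Lemma dist_intD_le theta phi :
  dist_int (theta + phi) <= dist_int theta + dist_int phi.
Proof. by rewrite -{1}(opprK phi) -(dist_intN phi) dist_intB_le. Qed.

Lemma dist_int_perturb theta phi :
  dist_int theta <= dist_int phi + `|theta - phi|.
Proof.
rewrite -{1}(subrK phi theta) addrC; apply: le_trans (dist_intD_le _ _) _.
by rewrite lerD2l dist_int_le_norm.
Qed.

Lemma dist_int_small theta : `|theta| <= 2^-1 -> dist_int theta = `|theta|.
Proof.
move=> th; apply/eqP; rewrite eq_le dist_int_le_norm /=.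
rewrite -norm_residue /residue; set x := nearest theta.
apply/mx_norm_lub => // i j.
have thij : `|theta i j| <= 2^-1.
  by move/(mx_norm_lub _ (le_trans (normr_ge0 _) th)): th; exact.
have /(mx_norm_lub _ (normr_ge0 _)) := lexx `|theta - int_vec x|.
move/(_ i j); apply: le_trans; rewrite !mxE.
set t := theta i j in thij *; set k := x i j.
have [->|k0] := eqVneq k 0; first by rewrite subr0.
have : (k <= -1) || (1 <= k) by lia.
move: thij; rewrite ler_norml => /andP[t1 t2].
case/orP; rewrite -(ler_int R) ?rmorphN /= => k1;
  case: (ler0P t) => h1; case: (ler0P (t - k%:~R)) => h2; lra.
Qed.

(** Multiplication by [k] scales the distance exactly as long as the result
    stays in the cube of points of norm at most [1 / 2], where the norm and the distance agree. *)
Lemma dist_int_natmul (k : nat) theta :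
  k%:R * dist_int theta <= 2^-1 ->
  dist_int (k%:R *: theta) = k%:R * dist_int theta.
Proof.
move=> h; have kE : `|k%:R *: residue theta| = k%:R * dist_int theta.
  by rewrite normrZ normr_nat norm_residue.
rewrite -kE -dist_int_small ?kE //.
by rewrite /residue scalerBr -int_vecZ -int_vecN dist_int_shift.
Qed.

Lemma dist_int_le1 theta : dist_int theta <= 1.
Proof.
apply: le_trans (dist_int_le theta (\col_i Num.floor (theta i ord0))) _.
apply/mx_norm_lub => // i j; rewrite (ord1 j) !mxE.
have k1 := Num.Theory.floor_le (theta i ord0).
have k2 := floorD1_gt (theta i ord0).
rewrite intrD mulr1z in k2.
by rewrite ger0_norm ?subr_ge0 // lerBlDl ltW.
Qed.

(** Pigeonhole: reduce the coordinates modulo 1 and cut the unit cube into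
    [L ^ n] cells of side [1 / L]. Some cell receives at least [N / L ^ n] of
    the [N] multiples, and the difference of two of them is within [1 / L] of
    an integer point. *)
Lemma many_returns theta (L N : nat) : (0 < L)%N ->
  (N <= L ^ n * #|[set t : 'I_N | (dist_int (t%:R *: theta) <= L%:R^-1)%R]%SET|)%N.
Proof.
case: L => // L _; case: N => [//|N].
pose fr (t : nat) i := (t%:R *: theta) i ord0 - (Num.floor ((t%:R *: theta) i ord0))%:~R.
pose cell (t : 'I_N.+1) : {ffun 'I_n -> 'I_L.+1} :=
  [ffun i => inord (Num.truncn (L.+1%:R * fr t i))].
have fr01 t i : 0 <= fr t i < 1.
  have k1 := Num.Theory.floor_le ((t%:R *: theta) i ord0).
  have k2 := floorD1_gt ((t%:R *: theta) i ord0).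
  by rewrite /fr subr_ge0 k1 /= ltrBlDl; rewrite intrD in k2.
have cellP t i : (cell t i)%:R <= L.+1%:R * fr t i < (cell t i)%:R + 1.
  have /andP[f0 f1] := fr01 t i.
  have p0 : 0 <= L.+1%:R * fr t i by rewrite mulr_ge0.
  have tr := truncn_itv p0.
  rewrite /cell ffunE inordK ?natr1 //.
  rewrite -(ltr_nat R); case/andP: tr => + _; move/le_lt_trans; apply.
  by rewrite -[ltRHS]mulr1 ltr_pM2l.
pose B := [set t : 'I_N.+1 | dist_int (t%:R *: theta) <= L.+1%:R^-1]%SET.
have fiber c : (#|[set t : 'I_N.+1 | cell t == c]%SET| <= #|B|)%N.
  set F := [set t | _]%SET; have [->|[t0 t0F]] := set_0Vmem F; first by rewrite cards0.
  case: (arg_minnP (fun t : 'I_N.+1 => t : nat) t0F) => m mF mmin.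
  have {}mF : m \in F by [].
  have sub t : t \in F -> (t - m <= N)%N.
    by move=> _; apply: leq_trans (leq_subr _ _) _; rewrite -ltnS.
  have inj : {in F &, injective (fun t : 'I_N.+1 => inord (t - m) : 'I_N.+1)}.
    move=> t u tF uF /(congr1 val) /=; rewrite !inordK ?ltnS ?sub // => tu.
    by apply/val_inj => /=; have := mmin _ tF; have := mmin _ uF; lia.
  (* subtracting the least element of a cell keeps the differences
     nonnegative and below N *)
  rewrite -(card_in_imset inj); apply: subset_leq_card.
  apply/fintype.subsetP => _ /imsetP[t tF ->]; rewrite inE inordK ?ltnS ?sub //.
  have mt := mmin _ tF; move: tF mF; rewrite !inE => /eqP tc /eqP mc.
  pose x : 'cV[int]_n := \col_i (Num.floor ((t%:R *: theta) i ord0) -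
                     Num.floor ((m%:R *: theta) i ord0)).
  apply: le_trans (dist_int_le _ x) _.
  apply/mx_norm_lub => [|i j]; first by rewrite invr_ge0.
  rewrite (ord1 j).
  have -> : ((t - m)%:R *: theta - int_vec x) i ord0 = fr t i - fr m i.
    by rewrite /fr !mxE natrB // intrB; ring.
  have := cellP t i; have := cellP m i; rewrite tc mc.
  have L0 : 0 < L.+1%:R :> R by [].
  move=> /andP[a1 a2] /andP[b1 b2].
  rewrite -(ler_pM2l L0) divff ?gt_eqF // -[X in X * _]gtr0_norm // -normrM.
  by rewrite mulrBr ler_norml; apply/andP; split; lra.
have : (\sum_(c : {ffun 'I_n -> 'I_L.+1}) #|[set t : 'I_N.+1 | cell t == c]%SET| <=
        \sum_(c : {ffun 'I_n -> 'I_L.+1}) #|B|)%N by apply: leq_sum.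
rewrite sum_nat_const card_ffun !card_ord; apply: leq_trans.
rewrite -[X in (X <= _)%N]card_ord -sum1_card.
rewrite (partition_big cell predT) //=; apply: leq_sum => c _.
by rewrite sum1dep_card cardsE.
Qed.

End TorusNorm.

(** Among [L ^ n + 1] multiples at least two are counted by [many_returns], and
    one of them has a nonzero index. *)
Lemma dirichlet {R : realType} {n : nat} (theta : 'cV[R]_n) (L : nat) : (0 < L)%N ->
  exists k, [/\ (0 < k)%N, (k <= L ^ n)%N & dist_int (k%:R *: theta) <= L%:R^-1].
Proof.
move=> L0; have := many_returns theta L (L ^ n).+1 L0; set S := [set _ | _]%SET => hS.
have [k kS k0] : exists2 k, k \in S & k != 0.
  apply/exists_inP; apply: contraLR hS; rewrite negb_exists => /forallP h.
  rewrite -ltnNge ltnS; apply: (@leq_trans (L ^ n * 1)); last by rewrite muln1.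
  rewrite leq_mul2l; apply/orP; right.
  apply: (@leq_trans #|[set (0 : 'I_(L ^ n).+1)]%SET|); last by rewrite cards1.
  apply/subset_leq_card/fintype.subsetP => k kS; have := h k.
  by rewrite kS negbK inE.
by exists k; split; [rewrite lt0n; exact: k0 | rewrite -ltnS | move: kS; rewrite inE].
Qed.

(** * Growth of balls in a finite group *)

(** The model is a finite subgroup of a torus with its distance to 0, which is
    homogeneous as long as multiples do not wrap around. *)
Section GroupBalls.
Context {R : realType} {G : finZmodType} (nu : G -> R).
Hypothesis nuD : forall x y, nu (x + y) <= nu x + nu y.
Hypothesis nuN : forall x, nu (- x) = nu x.
Hypothesis nuM : forall (k : nat) x,
  k%:R * nu x <= 2^-1 -> nu (x *+ k) = k%:R * nu x.

Definition ball_set (r : R) : {set G} := [set x | nu x <= r]%SET.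
Definition ball_card (r : R) : nat := #|ball_set r|.

Lemma ball_card_le r r' : r <= r' -> (ball_card r <= ball_card r')%N.
Proof.
move=> rr; apply/subset_leq_card/fintype.subsetP => x; rewrite !inE => /le_trans.
exact.
Qed.

Lemma nu_ge0 x : 0 <= nu x.
Proof.
have nu0 : nu 0 = 0.
  by rewrite -(mulr0n (0 : G)) nuM mul0r // invr_ge0.
have := nuD x (- x); rewrite subrr nu0 nuN; lra.
Qed.

(** Map a pair [(a, b)] of points of the ball of radius [u] to [a *+ M + b]. If
    two pairs have the same image then the [M]-th multiple of [a - a'] has norm
    at most [2 u]; as nothing wraps around, [a - a'] has norm at most
    [2 u / M], and [a] determines [b]. Hence the bound on the fibers. *)
Lemma ball_card_multiple (M : nat) (u : R) : (0 < M)%N -> M%:R * (2 * u) <= 2^-1 ->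
  (ball_card u ^ 2 <= ball_card (M.+1%:R * u) * ball_card (2 * u / M%:R))%N.
Proof.
move=> M0 Mu; have M0' : 0 < M%:R :> R by rewrite ltr0n.
have nuB x y : nu (x - y) <= nu x + nu y by rewrite -(nuN y) nuD.
pose S := ball_set u; pose f (p : G * G) := p.1 *+ M + p.2.
have uS x : x \in S -> nu x <= u by rewrite inE.
have fS p : p \in finset.setX S S -> f p \in ball_set (M.+1%:R * u).
  case: p => a b; rewrite finset.in_setX /= => /andP[aS bS]; rewrite inE.
  have Ma : M%:R * nu a <= M%:R * u by rewrite ler_pM2l // uS.
  apply: le_trans (nuD _ _) _; rewrite nuM /=; last first.
    have u0 : 0 <= u by apply: le_trans (uS _ aS); exact: nu_ge0.
    by apply: le_trans Ma _; lra.
  by rewrite -natr1; have := uS _ bS; lra.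
rewrite -mulnn -{1}[ball_card u]/#|S| -cardsX -sum1_card (partition_big _ _ fS) /=.
rewrite -[X in (_ <= X * _)%N]sum1_card big_distrl /=; apply: leq_sum => x _.
rewrite mul1n sum1dep_card; set F := [set p | _]%SET.
have [->|[p0 p0F]] := set_0Vmem F; first by rewrite cards0.
have inj : {in F &, injective (fun p : G * G => p.1 - p0.1)}.
  move=> [a b] [c d]; rewrite !inE /f /= => /andP[_ /eqP h1] /andP[_ /eqP h2].
  move=> /addIr ac; rewrite ac in h1 *; congr (_, _).
  by apply: (@addrI _ (c *+ M)); rewrite h1 h2.
rewrite -(card_in_imset inj); apply/subset_leq_card/fintype.subsetP.
move=> _ /imsetP[[a b] pF ->]; move: p0F pF; case: p0 {inj} => a0 b0.
rewrite !inE /f /= => /andP[/andP[ha0 hb0] /eqP h0] /andP[/andP[ha hb] /eqP h1].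
rewrite ler_pdivlMr // mulrC -nuM.
  have -> : (a - a0) *+ M = b0 - b.
    by rewrite mulrnBl; apply/eqP; rewrite subr_eq addrAC -subr_eq opprK h1 addrC h0.
  by have := nuB b0 b; lra.
by apply: le_trans Mu; rewrite ler_pM2l //; have := nuB a a0; lra.
Qed.

(** Up to the factor 8, [u] is the geometric mean of [U] and [8 u ^ 2 / U], so
    this is midpoint convexity of the logarithm of the ball count as a function
    of the logarithm of the radius. *)
Lemma ball_card_logconvex (u U : R) : 0 < u -> u <= U -> U <= 4^-1 ->
  (ball_card u ^ 2 <= ball_card U * ball_card (8 * u ^+ 2 / U))%N.
Proof.
move=> u0 uU U4; have U0 : 0 < U by lra.
have [Uu|uU2] := ltP U (2 * u).
  rewrite -mulnn; apply: leq_mul; apply: ball_card_le => //.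
  by rewrite ler_pdivlMr //; nra.
have xge : 2 <= U / u by rewrite ler_pdivlMr.
have x0 : 0 <= U / u by lra.
have /andP[k1 k2] := truncn_itv x0.
have k_ge : (2 <= Num.truncn (U / u))%N by rewrite truncn_ge_nat.
case: (Num.truncn (U / u)) k_ge k1 k2 => [|[|M]] // _ k1 k2.
rewrite ler_pdivlMr // in k1; rewrite ltr_pdivrMr // in k2.
rewrite -!natr1 in k1 k2 *.
apply: leq_trans (ball_card_multiple M.+1 u _ _) _ => //.
  by rewrite -natr1; lra.
have Mr0 : 0 <= M%:R :> R by [].
apply: leq_mul; apply: ball_card_le; rewrite -!natr1 //.
have M1 : 0 < M%:R + 1 :> R by lra.
by rewrite ler_pdivlMr // mulrAC ler_pdivrMr //; nra.
Qed.

End GroupBalls.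

(** A convex function lies below its chord. Here convexity holds only at
    midpoints and up to a factor; iterating it would lose a
    constant factor at each of many scales. A maximum principle loses only the
    factor [8 ^ s].
    Let [S] be the supremum of [g u = f u * u ^ (- s)] on [[B, r]]. Then
    [g u ^ 2 <= 8 ^ s * g r * S] for every [u]: apply convexity with larger
    radius [r] if the companion radius [8 u ^ 2 / r] is still at least [B], and
    otherwise with the larger radius for which the companion is [B], where
    [B ^ (- s) <= g r]. Taking the supremum over [u] gives [S <= 8 ^ s * g r]. *)
Lemma logconvex_chord {R : realType} (f : R -> R) (B r s C : R) :
  0 < B -> B <= r -> 0 <= s ->
  (forall u, 0 <= f u <= C) -> {homo f : x y / x <= y} ->
  (forall u U, 0 < u -> u <= U -> U <= r -> f u ^+ 2 <= f U * f (8 * u ^+ 2 / U)) ->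
  f B <= 1 -> B `^ (- s) <= f r * r `^ (- s) ->
  forall u, B <= u -> u <= r -> f u <= 8 `^ s * f r * (u / r) `^ s.
Proof.
move=> B0 Br s0 fC fmono conv fB1 ends u0 Bu0 u0r.
have r0 : 0 < r by lra.
pose p (x : R) := x `^ (- s); pose g u := f u * p u.
have p0 x : 0 <= p x by exact: powR_ge0.
have f0 x : 0 <= f x by have /andP[] := fC x.
have g0 x : 0 <= g x by rewrite mulr_ge0.
have pM x y : 0 <= x -> 0 <= y -> p (x * y) = p x * p y.
  by move=> ? ?; rewrite /p powRM.
have pmono x y : 0 < x -> x <= y -> p y <= p x.
  move=> x0 xy; rewrite /p !powRN lef_pV2 ?posrE ?powR_gt0 //; last by lra.
  by rewrite ge0_ler_powR // nnegrE; lra.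
have p8 : 8 `^ s * p 8 = 1 by rewrite /p powRN divff // gt_eqF // powR_gt0.
have e80 : 0 <= 8 `^ s :> R by exact: powR_ge0.
have step u : B <= u -> u <= r ->
    exists2 u', B <= u' <= r & g u ^+ 2 <= 8 `^ s * g r * g u'.
  move=> Bu ur; have u_gt0 : 0 < u by lra.
  have [lt_B|ge_B] := ltP (8 * u ^+ 2 / r) B.
    (* the larger radius U is chosen so that its companion is B *)
    have U_r : 8 * u ^+ 2 / B <= r.
      by move: lt_B; rewrite ltr_pdivrMr // ler_pdivrMr // [r * B]mulrC => /ltW.
    have u_U : u <= 8 * u ^+ 2 / B by rewrite ler_pdivlMr //; nra.
    set U := 8 * u ^+ 2 / B in U_r u_U; exists U; first by rewrite U_r andbT; lra.
    have U0 : 0 < U by lra.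
    have UB : U * B = 8 * (u * u) by rewrite /U divfK ?gt_eqF.
    have := conv u U u_gt0 u_U U_r.
    have -> : 8 * u ^+ 2 / U = B by rewrite expr2 -UB mulrAC divff ?mul1r // gt_eqF.
    move=> fu; have fuU : f u ^+ 2 <= f U by apply: le_trans fu _; rewrite ler_piMr.
    have pp : p u * p u = 8 `^ s * p B * p U.
      have : p U * p B = p 8 * (p u * p u) by rewrite -!pM ?UB; nra.
      by move=> h; rewrite -mulrA [p B * _]mulrC h mulrA p8 mul1r.
    rewrite /g exprMn expr2 [p u ^+ 2]expr2 pp -expr2.
    apply: le_trans (ler_wpM2r _ fuU) _; first by rewrite !mulr_ge0.
    have -> : f U * (8 `^ s * p B * p U) = 8 `^ s * f U * p U * p B by ring.
    have -> : 8 `^ s * (f r * p r) * (f U * p U) =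
              8 `^ s * f U * p U * (f r * p r) by ring.
    by rewrite ler_wpM2l // !mulr_ge0.
  have [le_r|gt_r] := leP (8 * u ^+ 2 / r) r.
    exists (8 * u ^+ 2 / r); first by rewrite ge_B.
    set u' := 8 * u ^+ 2 / r in ge_B le_r *.
    have u'r : u' * r = 8 * (u * u) by rewrite /u' divfK ?gt_eqF.
    have pp : p u * p u = 8 `^ s * p r * p u'.
      have : p u' * p r = p 8 * (p u * p u) by rewrite -!pM ?u'r; nra.
      by move=> h; rewrite -mulrA [p r * _]mulrC h mulrA p8 mul1r.
    rewrite /g exprMn [p u ^+ 2]expr2 pp.
    have -> : 8 `^ s * (f r * p r) * (f u' * p u') =
              (f r * f u') * (8 `^ s * p r * p u') by ring.
    by apply: ler_wpM2r; [rewrite !mulr_ge0 | exact: conv].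
  (* here u is so close to r that monotonicity suffices *)
  exists r; first by rewrite lexx andbT.
  rewrite ltr_pdivlMr // in gt_r.
  have pp : p u * p u <= 8 `^ s * (p r * p r).
    have : p (8 * (u * u)) <= p (r * r) by apply: pmono => //; nra.
    rewrite (pM 8) ?(pM u) ?(pM r) ?mulr_ge0 ?(ltW u_gt0) ?(ltW r0) // => h.
    have := ler_wpM2l e80 h; by rewrite [X in X <= _]mulrA p8 mul1r.
  rewrite /g exprMn [p u ^+ 2]expr2.
  have -> : 8 `^ s * (f r * p r) * (f r * p r) =
              (f r * f r) * (8 `^ s * (p r * p r)) by ring.
  apply: ler_pM => //; rewrite ?mulr_ge0 ?sqr_ge0 //.
  by rewrite expr2 ler_pM // fmono.
pose E := [set g u | u in [set u | B <= u <= r]].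
have Esup : has_sup E.
  split; first by exists (g B), B => //=; rewrite lexx.
  exists (C * p B) => _ [u /= /andP[Bu ur] <-].
  by rewrite ler_pM // ?pmono //; have /andP[] := fC u.
have ub u : B <= u -> u <= r -> g u <= sup E.
  by move=> Bu ur; apply: sup_upper_bound => //; exists u => //=; rewrite Bu.
have gr0 : 0 < g r by apply: lt_le_trans ends; exact: powR_gt0.
have supE0 : 0 < sup E by apply: lt_le_trans gr0 (ub _ _ _) => //.
have c0 : 0 <= 8 `^ s * g r by rewrite mulr_ge0.
have sup_sqrt : sup E <= Num.sqrt (8 `^ s * g r * sup E).
  apply: ge_sup; first by case: Esup.
  move=> _ [u /= /andP[Bu ur] <-].
  rewrite -(ger0_norm (g0 u)) -sqrtr_sqr ler_sqrt ?mulr_ge0 ?(ltW supE0) //.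
  have [u' /andP[Bu' u'r] h] := step u Bu ur; apply: le_trans h _.
  by rewrite ler_wpM2l // ub.
have supE : sup E <= 8 `^ s * g r.
  rewrite -(ler_pM2r supE0) -expr2.
  rewrite -[leRHS]sqr_sqrtr ?mulr_ge0 ?(ltW supE0) //.
  by rewrite ler_sqr ?nnegrE ?sqrtr_ge0 // ltW.
have u00 : 0 < u0 by lra.
have := le_trans (ub _ Bu0 u0r) supE; rewrite /g /p powRN.
rewrite ler_pdivrMr ?powR_gt0 // => /le_trans; apply.
have -> : (u0 / r) `^ s = r `^ (- s) * u0 `^ s.
  by rewrite powRM ?invr_ge0 1?ltW // mulrC -powR_inv1 ?ltW // -powRrM mulN1r.
by rewrite !mulrA.
Qed.

(** * The rational model of an orbit segment *)

(** If the [Q]-th multiple of [A] is the first one within [rho] of an integer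
    point [P], then the first [Q] multiples of [A] stay within [rho] of those of
    [P / Q], which form a finite subgroup of the torus, cyclic of order [Q]. *)
Section RationalModel.
Context {R : realType} {n : nat} (A : 'cV[R]_n) (q : nat) (rho : R).
Local Notation Q := q.+1.
Hypothesis close : dist_int (Q%:R *: A) <= rho.
Hypothesis separated : forall k, (0 < k)%N -> (k < Q)%N -> rho < dist_int (k%:R *: A).

Definition rational_approx : 'cV[R]_n := Q%:R^-1 *: int_vec (nearest (Q%:R *: A)).
Local Notation theta := rational_approx.
Definition rational_norm (x : 'I_Q) : R := dist_int ((x : nat)%:R *: theta).
Local Notation nu := rational_norm.

Let Q0 : 0 < Q%:R :> R. Proof. by []. Qed.

Lemma rho_ge0 : 0 <= rho.
Proof. by apply: le_trans close; exact: dist_int_ge0. Qed.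

Lemma rational_approx_close (z : R) :
  `|z *: A - z *: theta| <= `|z| / Q%:R * rho.
Proof.
rewrite -scalerBr normrZ -mulrA ler_wpM2l //.
rewrite -(ler_pM2l Q0) mulrA divff ?gt_eqF // mul1r.
rewrite -[X in X * _]normr_nat -normrZ scalerBr /theta scalerA divff ?gt_eqF //.
by rewrite scale1r; apply: le_trans close; rewrite -norm_residue.
Qed.

Lemma rational_approx_period k :
  (k * Q)%N%:R *: theta = int_vec (nearest (Q%:R *: A) *+ k).
Proof.
rewrite int_vecZ natrM -scalerA; congr (_ *: _).
by rewrite /theta scalerA divff ?gt_eqF // scale1r.
Qed.

Lemma dist_int_modn k : dist_int ((k %% Q)%N%:R *: theta) = dist_int (k%:R *: theta).
Proof.
have -> : k%:R *: theta =
    (k %% Q)%N%:R *: theta + int_vec (nearest (Q%:R *: A) *+ (k %/ Q)).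
  rewrite {1}(divn_eq k Q) natrD scalerDl addrC; congr (_ + _).
  exact: rational_approx_period.
by rewrite dist_int_shift.
Qed.

Lemma rational_normD (x y : 'I_Q) : nu (x + y) <= nu x + nu y.
Proof. by rewrite /nu dist_int_modn natrD scalerDl dist_intD_le. Qed.

Lemma rational_normN (x : 'I_Q) : nu (- x) = nu x.
Proof.
rewrite /nu dist_int_modn natrB; last by rewrite ltnW.
rewrite scalerBl /theta scalerA divff ?gt_eqF // scale1r addrC.
by rewrite dist_int_shift dist_intN.
Qed.

Lemma rational_normM k (x : 'I_Q) :
  k%:R * nu x <= 2^-1 -> nu (x *+ k) = k%:R * nu x.
Proof.
move=> h; rewrite -dist_int_natmul // /nu.
have -> : x *+ k = inZp (x * k)%N.
  by rewrite -Zp_mulrn.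
by rewrite /= dist_int_modn natrM mulrC scalerA.
Qed.

Lemma rational_norm_sub (x y : 'I_Q) :
  nu (x - y) = dist_int ((x : nat)%:R *: theta - (y : nat)%:R *: theta).
Proof.
set z := x - y.
have xy : ((z + y) %% Q)%N = x by have /(congr1 (@nat_of_ord _)) := subrK y x.
rewrite /nu -[in RHS](dist_int_shift _ (nearest (Q%:R *: A) *+ ((z + y) %/ Q))).
congr dist_int; rewrite -rational_approx_period.
apply: (addIr ((y : nat)%:R *: theta)); rewrite addrAC subrK.
by rewrite -!scalerDl -!natrD {1}(divn_eq (z + y) Q) xy addnC.
Qed.

(** A multiple of [A] of index at most [Q / 2] is within [rho / 2] of the
    corresponding multiple of [theta], so the separation of the orbit of [A] is
    inherited up to a factor 2; larger indices reduce to these by symmetry. *)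
Lemma rational_norm_separated (x : 'I_Q) : nu x <= rho / 2 -> x = 0.
Proof.
have half (y : 'I_Q) : y != 0 -> (2 * y <= Q)%N -> rho / 2 < nu y.
  move=> y0 y2; have := separated y; rewrite lt0n ltn_ord => /(_ y0 isT).
  move=> /lt_le_trans /(_ (dist_int_perturb _ ((y : nat)%:R *: theta))).
  have yQ2 : 2 * (y : nat)%:R <= Q%:R :> R by rewrite -natrM ler_nat.
  have := rational_approx_close (y : nat)%:R; rewrite normr_nat => h1 h2.
  have : (y : nat)%:R / Q%:R * rho <= 2^-1 * rho.
    rewrite ler_wpM2r ?rho_ge0 // ler_pdivrMr //; lra.
  move=> h3; have := lt_le_trans h2 (lerD (lexx _) (le_trans h1 h3)).
  by rewrite /nu; move: (dist_int _) => d hd; lra.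
move=> xr; apply/eqP/negP => /negP x0.
have [x2|x2] := leqP (2 * x) Q; first by have := half _ x0 x2; lra.
have := half (- x); rewrite oppr_eq0 => /(_ x0).
have -> : ((- x : 'I_Q) : nat) = (Q - x)%N.
  by rewrite /= modn_small // ltn_subrL lt0n andbT; exact: x0.
rewrite rational_normN => h; have : (2 * (Q - x) <= Q)%N by lia.
by move/h; lra.
Qed.

Lemma rational_ball_bottom : (ball_card nu (rho / 2) <= 1)%N.
Proof.
apply: (@leq_trans #|[set (0 : 'I_Q)]%SET|); last by rewrite cards1.
apply/subset_leq_card/fintype.subsetP => x.
by rewrite !inE => /rational_norm_separated ->.
Qed.

End RationalModel.

Section Steps.
Context {R : realType} {n : nat} (A : 'cV[R]_n).

(** The index 0 is excluded so that the sums of return times formed later are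
    strictly increasing. *)
Definition return_times (r : R) (Q : nat) : {set 'I_Q} :=
  [set t : 'I_Q | (0 < t)%N && (dist_int ((t : nat)%:R *: A) <= r)]%SET.

Definition steps (r : R) (Q : nat) : seq 'cV[R]_n :=
  [seq residue ((t : nat)%:R *: A) | t : 'I_Q <- enum (return_times r Q)].

Lemma size_steps r Q : size (steps r Q) = #|return_times r Q|.
Proof. by rewrite size_map -cardE. Qed.

Lemma count_steps r Q (P : pred 'cV[R]_n) : count P (steps r Q) =
  #|[set t in return_times r Q | P (residue ((t : nat)%:R *: A))]%SET|.
Proof.
rewrite count_map -size_filter cardE; congr size.
rewrite /enum_mem -filter_predI; apply: eq_filter => t /=.
by rewrite !inE andbC.
Qed.

Lemma stepsP r Q y : y \in steps r Q -> `|y| <= r /\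
  exists t, [/\ (0 < t)%N, (t < Q)%N & y = residue (t%:R *: A)].
Proof.
move=> /mapP[t]; rewrite mem_enum inE => /andP[t0 tr] ->.
by rewrite norm_residue; split => //; exists t.
Qed.

End Steps.

(** * Return times are regularly distributed *)

Section StepCounts.
Context {R : realType} {n : nat} (A : 'cV[R]_n) (q : nat) (rho : R).
Local Notation Q := q.+1.
Hypothesis close : dist_int (Q%:R *: A) <= rho.
Hypothesis separated : forall k, (0 < k)%N -> (k < Q)%N -> rho < dist_int (k%:R *: A).
Local Notation theta := (rational_approx A q).
Local Notation nu := (rational_norm A q).

Lemma rational_approx_within (z : R) : `|z| <= Q%:R ->
  `|z *: A - z *: theta| <= rho.
Proof.
move=> zQ; apply: le_trans (rational_approx_close _ _ _ close _) _.
rewrite ler_piMl ?(rho_ge0 _ _ _ close) //.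
by rewrite ler_pdivrMr ?mul1r.
Qed.

Lemma card_return_times_ge r : rho <= r / 2 ->
  (ball_card nu (r / 2) <= #|return_times A r Q|.+1)%N.
Proof.
move=> rr; rewrite /ball_card (cardsD1 (0 : 'I_Q)) -[X in (_ <= X)%N]add1n leq_add ?leq_b1 //.
apply/subset_leq_card/fintype.subsetP => t; rewrite !inE => /andP[t0 tr].
rewrite lt0n; apply/andP; split; first exact: t0.
apply: le_trans (dist_int_perturb _ ((t : nat)%:R *: theta)) _.
have : `|(t : nat)%:R : R| <= Q%:R by rewrite normr_nat ler_nat ltnW.
move/rational_approx_within => h; rewrite [r]splitr.
by apply: lerD tr _; exact: le_trans h rr.
Qed.

Lemma dist_int_residueB_le (t t' : nat) :
  dist_int (t%:R *: A - t'%:R *: A) <= `|residue (t%:R *: A) - residue (t'%:R *: A)|.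
Proof.
set u := t%:R *: A; set u' := t'%:R *: A.
have -> : u - u' = residue u - residue u' + int_vec (nearest u - nearest u').
  by apply/matrixP => i j; rewrite !mxE intrB; ring.
by rewrite dist_int_shift dist_int_le_norm.
Qed.

(** Subtracting a fixed return time sends the others injectively into a ball
    around 0 of the rational model; the radius doubles because the center [y]
    need not be a point of the orbit. *)
Lemma count_steps_le r (y : 'cV[R]_n) u :
  (count (fun z => `|z - y| <= u)%R (steps A r Q) <= ball_card nu (2 * u + rho))%N.
Proof.
rewrite count_steps; set X := [set t in _ | _]%SET.
have [->|[t0 t0X]] := set_0Vmem X; first by rewrite cards0.
have inj : {in X &, injective (fun t => t - t0)} by move=> t t' _ _ /addIr.
rewrite -(card_in_imset inj); apply/subset_leq_card/fintype.subsetP.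
move=> _ /imsetP[t tX ->]; rewrite inE (rational_norm_sub A).
have in_ball t' : t' \in X -> `|residue ((t' : nat)%:R *: A) - y| <= u.
  by rewrite inE => /andP[].
have := dist_int_perturb ((t : nat)%:R *: theta - (t0 : nat)%:R *: theta)
  ((t : nat)%:R *: A - (t0 : nat)%:R *: A).
move/le_trans; apply; apply: lerD.
  apply: le_trans (dist_int_residueB_le _ _) _.
  apply: le_trans (ler_distD y _ _) _.
  have := in_ball _ tX; have := in_ball _ t0X; rewrite (distrC y); lra.
rewrite -!scalerBl distrC; apply: rational_approx_within.
rewrite ler_norml.
have [tQ t0Q] : (t : nat)%:R <= Q%:R :> R /\ (t0 : nat)%:R <= Q%:R :> R.
  by rewrite !ler_nat; split; exact: ltnW.
have [? ?] : 0 <= (t : nat)%:R :> R /\ 0 <= (t0 : nat)%:R :> R by [].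
by apply/andP; split; lra.
Qed.

Lemma count_steps_le1 r (y : 'cV[R]_n) u : 2 * u <= rho ->
  (count (fun z => `|z - y| <= u)%R (steps A r Q) <= 1)%N.
Proof.
move=> u_rho; rewrite count_steps; apply/card_le1_eqP.
suff wlg (t t' : 'I_Q) : (t < t')%N ->
    `|residue ((t : nat)%:R *: A) - y| <= u ->
    `|residue ((t' : nat)%:R *: A) - y| <= u -> False.
  move=> t t'; rewrite !inE => /andP[_ tu] /andP[_ t'u]; apply/val_inj => /=.
  by have [lt|lt|//] := ltngtP t t'; [case: (wlg t t')|case: (wlg t' t)].
move=> tt' tu t'u.
have := separated (t' - t); rewrite subn_gt0 tt' => /(_ isT).
rewrite (leq_ltn_trans (leq_subr _ _) (ltn_ord t')) => /(_ isT).
apply/negP; rewrite -leNgt; apply: le_trans u_rho.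
rewrite natrB ?(ltnW tt') // scalerBl.
apply: le_trans (dist_int_residueB_le _ _) _.
apply: le_trans (ler_distD y _ _) _; rewrite (distrC y); lra.
Qed.

Lemma ball_card_ge r L : (0 < L)%N -> L%:R^-1 <= r ->
  (Q <= L ^ n * ball_card nu r)%N.
Proof.
move=> L0 Lr; apply: leq_trans (many_returns theta L Q L0) _.
by rewrite leq_mul2l; apply/orP; right; exact: (ball_card_le nu _ _ Lr).
Qed.

End StepCounts.

(** The chord bound on [[rho / 2, r / 2]], transferred to the orbit of [A]. A
    ball of radius [u] becomes a ball of radius [2 u + rho <= 4 u] of the model,
    hence the ratio [8 u / r] and the constant [8 ^ s * 8 ^ s]. *)
Lemma count_steps_frostman {R : realType} {n : nat} (A : 'cV[R]_n) (q : nat)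
    (rho r s : R) (y : 'cV[R]_n) u :
  dist_int (q.+1%:R *: A) <= rho ->
  (forall k, (0 < k)%N -> (k < q.+1)%N -> rho < dist_int (k%:R *: A)) ->
  0 < r -> r <= 4^-1 -> 0 <= s -> 0 < rho -> rho <= r / 4 ->
  (rho / 2) `^ (- s) <= (ball_card (rational_norm A q) (r / 2))%:R ->
  (ball_card (rational_norm A q) (r / 2))%:R <= 2 * (size (steps A r q.+1))%:R :> R ->
  rho < 2 * u ->
  (count (fun z => `|z - y| <= u) (steps A r q.+1))%:R <=
    2 * 64 `^ s * (u / r) `^ s * (size (steps A r q.+1))%:R.
Proof.
move=> close separated r0 r4 s0 rho0 rho_r bottom T_ge rho_u.
pose f (x : R) : R := (ball_card (rational_norm A q) x)%:R; rewrite -/(f _) in bottom T_ge.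
set cnt := count _ _; set T : R := (size _)%:R in T_ge *.
have T0 : 0 <= T by [].
have u0 : 0 < u by lra.
have ur0 : 0 < u / r by rewrite divr_gt0.
have f_le : cnt%:R <= f (2 * u + rho) by rewrite ler_nat; exact: count_steps_le.
have [in_range|out] := leP (2 * u + rho) (r / 2); last first.
  have : cnt%:R <= T by rewrite ler_nat count_size.
  move/le_trans; apply; rewrite ler_peMl // -mulrA -powRM ?(ltW ur0) //.
  have : 1 <= (64 * (u / r)) `^ s by apply: powR_ge1 => //; rewrite mulrA ler_pdivlMr //; lra.
  by clear; lra.
have f_conv u1 U1 : 0 < u1 -> u1 <= U1 -> U1 <= r / 2 ->
    f u1 ^+ 2 <= f U1 * f (8 * u1 ^+ 2 / U1).
  move=> u10 u1U U1r; rewrite /f -natrX -natrM ler_nat.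
  apply: ball_card_logconvex => //; first exact: rational_normD.
  - exact: rational_normN.
  - exact: rational_normM.
  - by clear -U1r r4; lra.
have f_mono : {homo f : x y / x <= y}.
  by move=> a b ab; rewrite /f ler_nat ball_card_le.
have f_bounded u1 : 0 <= f u1 <= q.+1%:R.
  by rewrite /f ler0n /= ler_nat -[X in (_ <= X)%N]card_ord max_card.
have f_bottom : f (rho / 2) <= 1.
  by rewrite /f lern1; exact: (rational_ball_bottom A q rho close separated).
have ends : (rho / 2) `^ (- s) <= f (r / 2) * (r / 2) `^ (- s).
  apply: le_trans bottom _; rewrite ler_peMr // powRN invf_ge1 ?powR_gt0 ?divr_gt0 //.
  by apply: powR_le1 => //; [rewrite divr_ge0 ?ltW | clear -r4; lra].
have rho2 : 0 < rho / 2 by rewrite divr_gt0.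
have rho_r2 : rho / 2 <= r / 2 by clear -rho_r rho0 r0; lra.
have u_bottom : rho / 2 <= 2 * u + rho by clear -rho_u rho0; lra.
have := logconvex_chord f (rho / 2) (r / 2) s q.+1%:R rho2 rho_r2 s0 f_bounded f_mono
  f_conv f_bottom ends (2 * u + rho) u_bottom in_range.
move/(le_trans f_le)/le_trans; apply.
have h8 : ((2 * u + rho) / (r / 2)) `^ s <= 8 `^ s * (u / r) `^ s.
  rewrite -powRM ?(ltW ur0) // ge0_ler_powR ?nnegrE //.
  - by rewrite divr_ge0 //; clear -u0 rho0 r0; lra.
  - by rewrite mulr_ge0 // ltW.
  rewrite ler_pdivrMr ?divr_gt0 //.
  have -> : 8 * (u / r) * (r / 2) = 4 * u by field; rewrite gt_eqF.
  by clear -rho_u; lra.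
apply: le_trans (ler_wpM2l _ h8) _; first by rewrite mulr_ge0 ?powR_ge0.
have e64 : 64 `^ s = 8 `^ s * 8 `^ s :> R.
  by rewrite -powRM // -natrM.
rewrite e64; set e := 8 `^ s; set p := (u / r) `^ s.
have -> : e * f (r / 2) * (e * p) = e * e * p * f (r / 2) by clear; ring.
have -> : 2 * (e * e) * p * T = e * e * p * (2 * T) by clear; ring.
by rewrite ler_wpM2l // !mulr_ge0 ?powR_ge0.
Qed.

(** A point within twice this radius of a multiple of [A] of index at most [2 Q]
    is approximated by it to the exponent [v]. *)
Definition next_radius {R : realType} (v : R) (Q : nat) : R :=
  (2 * Q%:R) `^ (- v) / 2.

Lemma next_radius_gt0 {R : realType} (v : R) Q : (0 < Q)%N -> 0 < next_radius v Q.
Proof. by move=> Q0; rewrite divr_gt0 // powR_gt0 // mulr_gt0 // ltr0n. Qed.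

Lemma next_radius_powR {R : realType} (v s : R) Q : (0 < Q)%N ->
  next_radius v Q `^ s = Q%:R `^ (- (s * v)) / 2 `^ ((v + 1) * s).
Proof.
move=> Q0; rewrite /next_radius !powRM ?powR_ge0 ?invr_ge0 // -!powRrM.
have -> : 2^-1 `^ s = 2 `^ (- s) :> R by rewrite -powR_inv1 // -powRrM mulN1r.
rewrite -powRN mulrAC -powRD; last by apply/implyP.
by rewrite mulrC; congr (_ `^ _ * _ `^ _); ring.
Qed.

Definition scales_without_return {R : realType} {n : nat} (A : 'cV[R]_n) (w : R) :=
  forall X : R, exists2 Q : R, X <= Q &
    forall k : nat, (0 < k)%N -> k%:R <= Q -> Q `^ (- w) < dist_int (k%:R *: A).

Lemma first_return {R : realType} {n : nat} (A : 'cV[R]_n) (rho : R) : 0 < rho ->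
  exists q, dist_int (q.+1%:R *: A) <= rho /\
    forall k, (0 < k)%N -> (k < q.+1)%N -> rho < dist_int (k%:R *: A).
Proof.
move=> rho0; have exQ : exists k, (0 < k)%N && (dist_int (k%:R *: A) <= rho).
  have [k [k0 _ hk]] := dirichlet A (Num.truncn rho^-1).+1 (ltn0Sn _).
  exists k; rewrite k0; apply: le_trans hk _.
  by rewrite -[leRHS]invrK lef_pV2 ?posrE ?invr_gt0 // ltW // truncnS_gt.
case: (ex_minnP exQ) => [[//|q]] /= close minq; exists q; split => // k k0 kq.
rewrite ltNge; apply/negP => kr.
by have := minq k; rewrite k0 kr => /(_ isT); rewrite leqNgt kq.
Qed.

(** Choose a scale [X] at which no multiple of [A] of index up to [X] comes within
    [rho = X ^ (- w)] of an integer point, and let [Q] be the first return within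
    [rho]; then [Q > X]. The pigeonhole principle bounds the number of returns
    within [r] below by a constant times [Q], and [s * w < 1] makes this number
    larger than [(rho / 2) ^ (- s)] for large [Q]: this is the slope needed for the
    chord bound, which covers the radii [u > rho / 2]. A ball of smaller radius
    contains at most one step, and [s * v < 1] makes [1 / Q] smaller than [u ^ s]
    down to the next radius. *)
Lemma steps_regular {R : realType} {n : nat} (A : 'cV[R]_n) (v s w : R) :
  0 < v -> 0 < s -> s * v < 1 -> 0 < w -> s * w < 1 -> scales_without_return A w ->
  forall (r : R) (N : nat), 0 < r -> r <= 4^-1 -> exists Q : nat,
  [/\ (N <= Q)%N, (0 < size (steps A r Q))%N &
      forall y u, next_radius v Q <= u ->
       (count (fun z => `|z - y| <= u) (steps A r Q))%:R <=
         2 * 64 `^ s * (u / r) `^ s * (size (steps A r Q))%:R].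
Proof.
move=> v0 s0 sv w0 sw sparse r N r0 r4.
pose L := (Num.truncn (2 / r)).+1.
have Lr : L%:R^-1 <= r / 2.
  by rewrite -[leRHS]invf_div lef_pV2 ?posrE ?divr_gt0 // ltW // truncnS_gt.
pose c : R := (L ^ n)%N%:R.
have c1 : 1 <= c by rewrite /c ler1n expn_gt0.
have c0 : 0 < c := lt_le_trans ltr01 c1.
have sw0 : 0 < 1 - s * w by rewrite subr_gt0.
have sv0 : 0 < 1 - s * v by rewrite subr_gt0.
(* X1 makes rho small against r, X2 gives the slope of the chord, X3 serves the
   balls with at most one step; X >= 2 c yields a return other than 0 *)
have [X1 X1_0 hX1] := powR_large w (4 / r) w0.
have [X2 X2_0 hX2] := powR_large (1 - s * w) (c * 2 `^ s) sw0.
have [X3 X3_0 hX3] := powR_large (1 - s * v) (2 * c * 2 `^ ((v + 1) * s)) sv0.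
have N0 : 0 <= N%:R :> R by [].
have [X XX hX] := sparse (X1 + X2 + X3 + 2 * c + N%:R).
have [XX1 XX2 XX3 Xc XN] : [/\ X1 <= X, X2 <= X, X3 <= X, 2 * c <= X & N%:R <= X].
  by clear -XX X1_0 X2_0 X3_0 c0 N0; split; lra.
have X0 : 0 < X := lt_le_trans X1_0 XX1.
clear XX X1_0 X2_0 X3_0 N0.
pose rho := X `^ (- w).
have rho0 : 0 < rho by exact: powR_gt0.
have rho_r : rho <= r / 4.
  rewrite /rho powRN -[leRHS]invf_div lef_pV2 ?posrE ?powR_gt0 ?divr_gt0 //.
  exact: hX1.
have [q [close separated]] := first_return A rho rho0.
have XQ : X < q.+1%:R.
  rewrite ltNge; apply/negP => /(hX q.+1 (ltn0Sn _)).
  by apply/negP; rewrite -leNgt.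
have Q0 : 0 < q.+1%:R :> R by [].
exists q.+1; pose B : R := (ball_card (rational_norm A q) (r / 2))%:R.
have B_ge : q.+1%:R <= c * B by rewrite /c /B -natrM ler_nat ball_card_ge.
set T := steps A r q.+1.
have T_ge : B <= 2 * (size T)%:R.
  have rr : rho <= r / 2 by clear -rho_r r0; lra.
  have := card_return_times_ge A q rho close r rr.
  rewrite -(ler_nat R) -natr1 -size_steps -/B -/T => h1.
  have : 2 * c <= c * B := le_trans Xc (le_trans (ltW XQ) B_ge).
  by rewrite mulrC ler_pM2l // => h2; clear -h1 h2; lra.
have QT : q.+1%:R <= 2 * c * (size T)%:R.
  by apply: le_trans B_ge _; rewrite [2 * c]mulrC -mulrA ler_pM2l.
split.
- by rewrite -(ler_nat R); exact: le_trans XN (ltW XQ).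
- rewrite -(ltr0n R) -(pmulr_rgt0 _ (mulr_gt0 (ltr0n R 2) c0)).
  exact: lt_le_trans Q0 QT.
move=> y u u_next.
have u0 : 0 < u by apply: lt_le_trans u_next; exact: next_radius_gt0.
have [u_rho|rho_u] := leP (2 * u) rho.
  apply: (@le_trans _ _ 1); first by rewrite lern1; exact: (count_steps_le1 A q rho separated).
  have us : next_radius v q.+1 `^ s <= (u / r) `^ s.
    rewrite ge0_ler_powR ?nnegrE ?(ltW s0) ?divr_ge0 ?(ltW u0) ?(ltW r0) //.
    apply: le_trans u_next _; rewrite ler_pdivlMr // ler_piMr ?(ltW u0) //.
    by clear -r4; lra.
  have k64 : 1 <= 2 * 64 `^ s :> R.
    have : 1 <= 64 `^ s :> R by apply: powR_ge1; [rewrite ler1n | exact: ltW].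
    by clear; lra.
  rewrite -mulrA; apply: le_trans (ler_peMl _ k64); last by rewrite mulr_ge0 ?powR_ge0.
  apply: le_trans (ler_wpM2r _ us); last by [].
  rewrite next_radius_powR // mulrAC ler_pdivlMr ?powR_gt0 // mul1r.
  rewrite -(ler_pM2l (mulr_gt0 (ltr0n R 2) c0)).
  apply: le_trans (hX3 _ (le_trans XX3 (ltW XQ))) _.
  rewrite mulrCA powRD; last by rewrite (gt_eqF Q0) implybT.
  by rewrite powRr1 ?(ltW Q0) // mulrC ler_wpM2l ?powR_ge0.
apply: (count_steps_frostman A q rho r s y u close separated) => //; first exact: ltW.
have -> : (rho / 2) `^ (- s) = X `^ (w * s) * 2 `^ s.
  rewrite powRM ?(ltW rho0) // /rho -powRrM mulrNN -powR_inv1 // -powRrM.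
  by rewrite mulN1r opprK.
rewrite -/B -(ler_pM2l c0); apply: le_trans B_ge.
have h1 := hX2 _ (le_trans XX2 (ltW XQ)).
have h2 : X `^ (w * s) <= q.+1%:R `^ (w * s).
  by rewrite ge0_ler_powR ?nnegrE ?mulr_ge0 ?(ltW w0) ?(ltW s0) ?(ltW X0) ?(ltW XQ).
rewrite mulrCA; apply: le_trans (ler_pM (powR_ge0 _ _) _ h2 h1) _.
  by rewrite mulr_ge0 ?powR_ge0 ?(ltW c0).
rewrite -powRD; last by rewrite (gt_eqF Q0) implybT.
by rewrite [s * w]mulrC addrC subrK powRr1 // ltW.
Qed.

(** * Sets of sums and mass distribution *)

Lemma count_allpairs_le {S T U : Type} {R : numDomainType} (f : S -> T -> U)
    (P : pred U) (P1 : pred S) (s : seq S) (t : seq T) (M : R) : 0 <= M ->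
  (forall x, has (fun y => P (f x y)) t -> P1 x) ->
  (forall x, (count (fun y => P (f x y)) t)%:R <= M) ->
  (count P [seq f x y | x <- s, y <- t])%:R <= M * (count P1 s)%:R.
Proof.
move=> M0 PP1 cM; elim: s => [|x s ih]; first by rewrite mulr0.
rewrite allpairs_cons count_cat natrD count_map /= natrD mulrDr.
apply: lerD ih; have [P1x|] := boolP (P1 x); first by rewrite mulr1 cM.
move/negP => nP1; rewrite mulr0; suff -> : count (preim (f x) P) t = 0%N by [].
by apply/eqP; rewrite -leqn0 leqNgt -has_count; apply/negP => /PP1.
Qed.

Lemma size_le_sum_count {T I : Type} (s : seq T) (l : seq I) (P : I -> pred T) :
  all (fun x => has (fun i => P i x) l) s ->
  (size s <= \sum_(i <- l) count (P i) s)%N.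
Proof.
elim: s => [|x s ih] //= /andP[hx /ih h].
rewrite big_split /= -add1n leq_add // {ih h s}.
elim: l hx => [|i l ih] //=; rewrite big_cons; case: (P i x) => //=.
Qed.

(** Convergent sums with the [k]-th term in the finite sequence [Y k], whose
    points have norm at most [rad k]. The uniform distribution on the partial
    sums plays the part of a measure; it is only ever counted. *)
Section SumSet.
Context {R : realType} {V : normedModType R} (Y : nat -> seq V) (rad : nat -> R).

Fixpoint partial_sums k : seq V :=
  if k is k'.+1 then [seq x + y | x <- partial_sums k', y <- Y k'] else [:: 0].

(** By compactness this is the set of sums of the series; membership in this
    form needs no coherent choice of terms, and makes closedness immediate. *)
Definition sum_set : set V :=
  [set x | forall k, exists2 c, c \in partial_sums k & `|x - c| <= 2 * rad k].

Definition near_count k (x : V) (u : R) : R :=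
  (count (fun z => `|z - x| <= u) (partial_sums k))%:R.

Definition total k : R := (size (partial_sums k))%:R.

Hypothesis rad_gt0 : forall j, 0 < rad j.
Hypothesis radS : forall j, rad j.+1 <= rad j / 4.
Hypothesis Y_size : forall j, (0 < size (Y j))%N.
Hypothesis Y_rad : forall j y, y \in Y j -> `|y| <= rad j.

Lemma totalS k : total k.+1 = (size (Y k))%:R * total k.
Proof. by rewrite /total /= size_allpairs natrM mulrC. Qed.

Lemma total_gt0 k : 0 < total k.
Proof.
elim: k => [|k ih]; first by rewrite /total /= ltr01.
by rewrite totalS mulr_gt0 // ltr0n.
Qed.

Lemma near_count_total k x u : near_count k x u <= total k.
Proof. by rewrite ler_nat count_size. Qed.

Lemma near_count_le k x u u' : u <= u' -> near_count k x u <= near_count k x u'.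
Proof. by move=> uu; rewrite ler_nat; apply: sub_count => z /= /le_trans; apply. Qed.

Lemma near_countS k x u M : 0 <= M ->
  (forall y, (count (fun z => `|z - y| <= u)%R (Y k))%:R <= M) ->
  near_count k.+1 x u <= M * near_count k x (u + rad k).
Proof.
move=> M0 hM; apply: count_allpairs_le => // z.
  move=> /hasP[y yY]; have yr := Y_rad _ _ yY => h.
  have -> : z - x = (z + y - x) - y by rewrite addrAC addrK.
  by apply: le_trans (ler_normB _ _) _; apply: lerD.
have -> : (fun y => `|z + y - x| <= u) = (fun y => `|y - (x - z)| <= u); last exact: hM.
by apply/funext => y; rewrite opprB addrA [y + z]addrC.
Qed.

Lemma near_countS_total k x u :
  near_count k.+1 x u <= (size (Y k))%:R * near_count k x (u + rad k).
Proof. by apply: near_countS => // y; rewrite ler_nat count_size. Qed.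

(** The terms from the [j]-th on move a point by less than [2 * rad j], so after
    enlarging the ball they contribute at most all their choices. *)
Lemma near_count_tail j d x u :
  near_count (j + d) x u * total j <=
  total (j + d) * near_count j x (u + 2 * rad j - 2 * rad (j + d)).
Proof.
elim: d u => [|d ih] u; first by rewrite addn0 addrK mulrC.
rewrite addnS totalS -mulrA.
have := near_countS_total (j + d) x u.
move/(ler_wpM2r (ltW (total_gt0 j)))/le_trans; apply; rewrite -mulrA.
apply: ler_wpM2l => //; apply: le_trans (ih _) _.
apply: ler_wpM2l; first exact/ltW/total_gt0.
apply: near_count_le; have := radS (j + d); have := rad_gt0 (j + d); lra.
Qed.

Section Frostman.
Variables (s s1 C : R).
Hypothesis s_ge0 : 0 <= s.
Hypothesis s_lt : s <= s1.
Hypothesis C_ge1 : 1 <= C.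
Hypothesis gap : forall j, C * (4 * (rad j.+1 / rad j)) `^ s1 <= (rad j.+1 / rad j) `^ s.
Hypothesis Y_count : forall j y u, rad j.+1 <= u ->
  (count (fun z => `|z - y| <= u)%R (Y j))%:R <= C * (u / rad j) `^ s1 * (size (Y j))%:R.

(** The count at the radius [4 * rad j] is multiplicative along the levels; [gap]
    absorbs the constant [C] of each level into the difference of the exponents
    [s] and [s1], so that no constant accumulates. *)
Lemma near_count_coarse j x :
  near_count j x (4 * rad j) <= (rad j / rad 0) `^ s * total j.
Proof.
elim: j x => [|j ih] x.
  by rewrite divff ?gt_eqF // powR1 mul1r near_count_total.
have r0 := rad_gt0 j; have r1 := rad_gt0 j.+1; have r00 := rad_gt0 0.
have rr := radS j.
set M := (rad j.+1 / rad j) `^ s * (size (Y j))%:R.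
have M0 : 0 <= M by rewrite mulr_ge0 ?powR_ge0.
apply: (@le_trans _ _ (M * near_count j x (4 * rad j.+1 + rad j))).
  apply: near_countS => // y; apply: le_trans (Y_count j y (4 * rad j.+1) _) _.
    lra.
  rewrite /M ler_wpM2r //; apply: le_trans _ (gap j).
  by rewrite mulrA.
apply: (@le_trans _ _ (M * ((rad j / rad 0) `^ s * total j))).
  apply: ler_wpM2l => //; apply: le_trans (ih x).
  by apply: near_count_le; lra.
rewrite totalS /M.
have -> : rad j.+1 / rad 0 = (rad j.+1 / rad j) * (rad j / rad 0).
  by rewrite mulrA divfK // gt_eqF.
rewrite [in leRHS]powRM ?divr_ge0 ?(ltW r0) ?(ltW r1) ?(ltW r00) //.
by rewrite le_eqVlt; apply/orP; left; apply/eqP; ring.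
Qed.

Definition frostman_const : R := C * 3 `^ s1 * (rad 0)^-1 `^ s.

Lemma frostman_const_gt0 : 0 < frostman_const.
Proof. by rewrite !mulr_gt0 ?powR_gt0 ?invr_gt0 //; apply: lt_le_trans C_ge1. Qed.

(** A radius [u] lies between [rad j.+1] and [rad j] for some [j]. The levels
    before [j] are controlled by the coarse count, the level [j] by [Y_count],
    and the later ones contribute their total number of points. *)
Lemma near_count_frostman k x u : rad k <= u ->
  near_count k x u <= frostman_const * u `^ s * total k.
Proof.
move=> ku; have r00 := rad_gt0 0; have u0 : 0 < u := lt_le_trans (rad_gt0 k) ku.
have s1_ge0 := le_trans s_ge0 s_lt.
have C3 : 1 <= C * 3 `^ s1.
  rewrite -[leLHS]mulr1 ler_pM //.
  have : 1 `^ s1 <= 3 `^ s1 :> R by rewrite ge0_ler_powR ?nnegrE //; lra.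
  by rewrite powR1.
have -> : frostman_const * u `^ s = C * 3 `^ s1 * (u / rad 0) `^ s.
  by rewrite powRM ?invr_ge0 ?ltW // /frostman_const -mulrA [_ * u `^ s]mulrC.
have [big|small] := leP (rad 0) u.
  apply: le_trans (near_count_total _ _ _) _; rewrite ler_peMl ?(ltW (total_gt0 k)) //.
  rewrite -[leLHS]mulr1 ler_pM //.
  have : 1 `^ s <= (u / rad 0) `^ s.
    by rewrite ge0_ler_powR ?nnegrE ?divr_ge0 ?(ltW u0) ?(ltW r00) // ler_pdivlMr ?mul1r.
  by rewrite powR1.
have exm : exists m, rad m <= u by exists k.
case: (ex_minnP exm) => [[|j]]; first by rewrite leNgt small.
move=> ju minj; have jk : (j < k)%N by exact: minj.
have uj : u < rad j by rewrite ltNge; apply/negP => /minj; rewrite ltnn.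
have r0 := rad_gt0 j; have r1 := rad_gt0 j.+1; have rr := radS j.
have := near_count_tail j.+1 (k - j.+1) x u; rewrite subnKC // => tail.
rewrite -(ler_pM2r (total_gt0 j.+1)); apply: le_trans tail _.
rewrite -[leRHS]mulrA [leRHS]mulrC -[leRHS]mulrA; apply: ler_wpM2l; first exact/ltW/total_gt0.
apply: (@le_trans _ _ (near_count j.+1 x (3 * u))).
  apply: near_count_le; have := rad_gt0 k; lra.
set M := C * (3 * u / rad j) `^ s1 * (size (Y j))%:R.
have C0 : 0 <= C := le_trans ler01 C_ge1.
have M0 : 0 <= M by rewrite !mulr_ge0 ?powR_ge0.
apply: (@le_trans _ _ (M * near_count j x (3 * u + rad j))).
  by apply: near_countS => // y; apply: Y_count; lra.
apply: (@le_trans _ _ (M * ((rad j / rad 0) `^ s * total j))).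
  apply: ler_wpM2l => //; apply: le_trans (near_count_coarse j x).
  by apply: near_count_le; lra.
have ur0 : 0 < u / rad j by rewrite divr_gt0.
have -> : u / rad 0 = (u / rad j) * (rad j / rad 0) by rewrite mulrA divfK // gt_eqF.
rewrite /M totalS -[3 * u / _]mulrA [(3 * (u / rad j)) `^ s1]powRM ?(ltW ur0) //.
rewrite [(u / rad j * _) `^ s]powRM ?(ltW ur0) ?divr_ge0 ?(ltW r0) ?(ltW r00) //.
have us : (u / rad j) `^ s1 <= (u / rad j) `^ s.
  by apply: ger_powR => //; rewrite ur0 /= ler_pdivrMr ?mul1r ?ltW.
set a := (rad j / rad 0) `^ s; set b := 3 `^ s1; set t := total j; set N := _%:R.
have -> : C * (b * (u / rad j) `^ s1) * N * (a * t) = (C * b * N * a * t) * (u / rad j) `^ s1 by ring.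
have -> : N * t * (C * b * ((u / rad j) `^ s * a)) = (C * b * N * a * t) * (u / rad j) `^ s by ring.
apply: ler_wpM2l us; have := total_gt0 j.
by move=> /ltW t0; rewrite !mulr_ge0 ?powR_ge0.
Qed.

End Frostman.

(** The bound carries [- 2 * rad (j + d)] so that the induction closes: one more
    term costs [rad (j + d)], and [rad] decreases by a factor 4. *)
Lemma partial_sums_ancestor j d c : c \in partial_sums (j + d) ->
  exists2 c', c' \in partial_sums j & `|c - c'| <= 2 * rad j - 2 * rad (j + d).
Proof.
elim: d c => [|d ih] c; first by rewrite addn0 => cj; exists c; rewrite ?subrr ?normr0.
rewrite addnS => /allpairsP[[x y] /= [xS yY ->]].
have [c' c'S h] := ih _ xS; exists c' => //.
rewrite addrAC; apply: le_trans (ler_normD _ _) _.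
have := Y_rad _ _ yY; have := radS (j + d); have := rad_gt0 (j + d); lra.
Qed.

Fixpoint head_path k (c : V) d : V :=
  if d is d'.+1 then head_path k c d' + head 0 (Y (k + d')) else c.

Lemma head_path_in k c d : c \in partial_sums k -> head_path k c d \in partial_sums (k + d).
Proof.
move=> ck; elim: d => [|d ih]; first by rewrite addn0.
rewrite addnS /=; apply/allpairsP; exists (head_path k c d, head 0 (Y (k + d))); split => //=.
by have := Y_size (k + d); case: (Y _) => //= y l _; rewrite inE eqxx.
Qed.

Lemma head_path_near k c d e :
  `|head_path k c (d + e) - head_path k c d| <= 2 * rad (k + d) - 2 * rad (k + (d + e)).
Proof.
elim: e => [|e ih]; first by rewrite addn0 !subrr normr0.
rewrite !addnS /= addrAC; apply: le_trans (ler_normD _ _) _.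
have hY : head 0 (Y (k + (d + e))) \in Y (k + (d + e)).
  by have := Y_size (k + (d + e)); case: (Y _) => //= y l _; rewrite inE eqxx.
have := Y_rad _ _ hY; have := radS (k + (d + e)); have := rad_gt0 (k + (d + e)); lra.
Qed.

Hypothesis compact_balls : forall r, compact [set x : V | `|x| <= r].

(** Follow the first element of each [Y j] from [c] on: a cluster point of the
    resulting sequence of partial sums is in the set. *)
Lemma sum_set_near k c : c \in partial_sums k ->
  exists2 x, sum_set x & `|x - c| <= 2 * rad k.
Proof.
move=> ck; pose z := head_path k c.
have zc d : `|z d - c| <= 2 * rad k.
  have := head_path_near k c 0 d; rewrite add0n addn0 => /le_trans; apply.
  have := rad_gt0 (k + d); lra.
have [] := compact_balls (`|c| + 2 * rad k) (z @ \oo) _.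
  exists 0%N => // d _ /=; have := zc d; have := ler_normD (z d - c) c.
  by rewrite subrK; lra.
move=> x [_ clx].
have xz d : `|x - z d| <= 2 * rad (k + d).
  apply/ler_addgt0Pr => e e0.
  have zF : (z @ \oo) [set y | `|y - z d| <= 2 * rad (k + d)].
    exists d => // m /= dm; have := head_path_near k c d (m - d).
    by rewrite subnKC //; have := rad_gt0 (k + m); rewrite /z; lra.
  have [y [/= yz]] := clx _ _ zF (nbhsx_ballx x e e0).
  rewrite -ball_normE /= => xy.
  by rewrite (le_trans (ler_distD y _ _)) // addrC lerD // ltW.
exists x; last by have := xz 0%N; rewrite addn0.
move=> j.
have : z j \in partial_sums (j + k) by rewrite addnC; exact: head_path_in.
move/partial_sums_ancestor => [c' c'S h]; exists c' => //.
apply: le_trans (ler_distD (z j) _ _) _; have := xz j; rewrite addnC; lra.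
Qed.

Lemma closed_sum_set : closed sum_set.
Proof.
have -> : sum_set = \bigcap_k [set x | exists2 c, c \in partial_sums k & `|x - c| <= 2 * rad k].
  by apply/seteqP; split => [x h k _|x h k]; apply: h.
apply: closed_bigI => k _; elim: (partial_sums k) => [|c l ih].
  have -> : [set x : V | exists2 c, c \in [::] & `|x - c| <= 2 * rad k] = set0.
    by apply/seteqP; split => // x [].
  exact: closed0.
have -> : [set x : V | exists2 c', c' \in c :: l & `|x - c'| <= 2 * rad k] =
    closed_ball_ Num.norm c (2 * rad k) `|` [set x | exists2 c', c' \in l & `|x - c'| <= 2 * rad k].
  apply/seteqP; split => x /=.
    move=> [c']; rewrite inE => /orP[/eqP ->|c'l h]; first by rewrite distrC; left.
    by right; exists c'.
  move=> [h|[c' c'l h]]; first by exists c; rewrite ?inE ?eqxx // distrC.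
  by exists c' => //; rewrite inE c'l orbT.
by apply: closedU => //; exact: closed_closed_ball_.
Qed.

Lemma compact_sum_set : compact sum_set.
Proof.
apply: (subclosed_compact closed_sum_set (compact_balls (2 * rad 0))) => x /(_ 0%N)[c].
by rewrite /= inE => /eqP ->; rewrite subr0.
Qed.

Lemma rad_small e : 0 < e -> exists k, rad k <= e.
Proof.
move=> e0; have r00 := rad_gt0 0.
have rk k : rad k * k.+1%:R <= rad 0.
  elim: k => [|k ih]; first by rewrite mulr1.
  apply: le_trans ih; have rk0 := rad_gt0 k.
  have h : rad k.+1 * k.+2%:R <= rad k / 4 * k.+2%:R by rewrite ler_wpM2r.
  have : 0 <= rad k * k%:R by rewrite mulr_ge0 // ltW.
  by move: h; rewrite -[k.+2%:R]natr1 -[k.+1%:R]natr1; lra.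
exists (Num.truncn (rad 0 / e)); have := rk (Num.truncn (rad 0 / e)).
have := truncnS_gt (rad 0 / e); rewrite ltr_pdivrMr //.
set m := _.+1%:R => h1 h2; have m0 : 0 < m by rewrite /m.
rewrite -(ler_pM2r m0); lra.
Qed.

Lemma rad_le j k : (j <= k)%N -> rad k <= rad j.
Proof.
move/subnKC => <-; elim: (k - j)%N => [|d ih]; first by rewrite addn0.
rewrite addnS; have := radS (j + d); have := rad_gt0 (j + d); lra.
Qed.

Lemma rad_small_all (rho : nat -> R) N : (forall i, 0 < rho i) ->
  exists k, forall i, (i < N)%N -> rad k <= rho i.
Proof.
move=> rho0; elim: N => [|N [k hk]]; first by exists 0%N.
have [k' hk'] := rad_small _ (rho0 N); exists (maxn k k') => i.
rewrite ltnS leq_eqVlt => /orP[/eqP ->|/hk h].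
  by apply: le_trans hk'; apply: rad_le; exact: leq_maxr.
by apply: le_trans h; apply: rad_le; exact: leq_maxl.
Qed.

(** Mass distribution. By compactness finitely many balls [i < N] suffice. At a
    level [k] so deep that [rad k] is below their radii, every partial sum is near
    a point of the set, hence within [3 * rho i] of some [z i]; counting the
    partial sums in these enlarged balls gives the bound. *)
Lemma sum_set_content (s D : R) (z : nat -> V) (rho : nat -> R) : 0 < D -> 0 <= s ->
  (forall k x u, rad k <= u -> near_count k x u <= D * u `^ s * total k) ->
  (forall i, 0 < rho i) -> (forall x, sum_set x -> exists i, `|z i - x| < rho i) ->
  exists N, (D * 3 `^ s)^-1 <= \sum_(0 <= i < N) rho i `^ s.
Proof.
move=> D0 s0 frost rho0 cov.
have := compact_sum_set; rewrite compact_cover.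
move=> /(_ nat setT (fun i => ball (z i) (rho i)))[].
- by move=> i _; exact: ball_open.
- by move=> x /cov[i h]; exists i => //; rewrite -ball_normE.
move=> I _ covI; pose N := (\max_(i <- enum_fset I) i).+1; exists N.
have covN x : sum_set x -> exists2 i, (i < N)%N & `|z i - x| < rho i.
  move=> /covI[i /= iI]; rewrite -ball_normE => h; exists i => //.
  by rewrite /N ltnS (big_rem i) //= leq_max leqnn.
have [k rk] := rad_small_all rho N rho0.
have allc : all (fun c => has (fun i => `|c - z i| <= 3 * rho i) (index_iota 0 N)) (partial_sums k).
  suff near_z (c : V) : c \in partial_sums k ->
      exists2 i, (i < N)%N & `|c - z i| <= 3 * rho i.
    by apply/allP => c /near_z[i iN h]; apply/hasP; exists i => //; rewrite mem_index_iota.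
  move=> /sum_set_near[x /covN[i iN xi] xc]; exists i => //.
  apply: le_trans (ler_distD x _ _) _; have := rk _ iN; rewrite (distrC c x) (distrC x (z i)); lra.
have := size_le_sum_count _ _ _ allc; rewrite -(ler_nat R) natr_sum -/(total k) => h.
have : total k <= \sum_(0 <= i < N) D * 3 `^ s * rho i `^ s * total k.
  apply: le_trans h _; rewrite big_seq [leRHS]big_seq; apply: ler_sum => i.
  rewrite mem_index_iota /= => iN.
  apply: le_trans (frost k (z i) (3 * rho i) _) _.
    by have := rk _ iN; have := rho0 i; lra.
  by rewrite powRM ?(ltW (rho0 i)) // mulrA.
rewrite -mulr_suml -{1}(mul1r (total k)) ler_pM2r ?total_gt0 // -mulr_sumr.
by rewrite -ler_pdivrMl ?mulr1 // mulr_gt0 ?powR_gt0.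
Qed.

End SumSet.

(** * Null sets of Hausdorff measures *)

Section HausdorffNull.
Context {R : realType} {V : normedModType R}.
Implicit Types (U E : set V) (s t e : R).

Lemma diam_ge0 U : (0 <= diam U)%E.
Proof. by apply: ereal_sup_ubound; left. Qed.

Lemma diam_ge U x y : U x -> U y -> (`|x - y|%:E <= diam U)%E.
Proof. by move=> Ux Uy; apply: ereal_sup_ubound; right; exists (x, y). Qed.

Lemma diam_le U r : 0 <= r -> (forall x y, U x -> U y -> `|x - y| <= r) ->
  (diam U <= r%:E)%E.
Proof.
move=> r0 h; apply: ge_ereal_sup => _ [->|[[x y] [/= Ux Uy] <-]].
  by rewrite lee_fin.
by rewrite lee_fin; exact: h.
Qed.

Lemma diam_pow_ge0 s U : (0 <= diam_pow s U)%E.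
Proof. by rewrite /diam_pow; case: ifP => // _; exact: poweR_ge0. Qed.

Lemma diam_pow_set0 s : diam_pow s (set0 : set V) = 0%E.
Proof. by rewrite /diam_pow eqxx. Qed.

Lemma diam_pow_le s U r : 0 <= s -> (diam U <= r%:E)%E ->
  (diam_pow s U <= (r `^ s)%:E)%E.
Proof.
move=> s0 Ur; rewrite /diam_pow; case: ifP => _; first by rewrite lee_fin powR_ge0.
rewrite -poweR_EFin; apply: gt0_ler_poweR => //; rewrite in_itv /= leey andbT.
  exact: diam_ge0.
exact: le_trans (diam_ge0 U) Ur.
Qed.

Lemma fine_diam_bounds U : (diam U <= 1%:E)%E ->
  0 <= fine (diam U) <= 1 /\ diam U = (fine (diam U))%:E.
Proof.
move=> U1; have U0 := diam_ge0 U.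
have fU : diam U \is a fin_num by rewrite ge0_fin_numE // (le_lt_trans U1) // ltry.
by rewrite fineK // -!lee_fin fineK // U0 U1.
Qed.

Lemma fine_diam_pow_le s t U : 0 <= t -> t <= s -> 0 < s -> (diam U <= 1%:E)%E ->
  ((fine (diam U) `^ s)%:E <= diam_pow t U)%E.
Proof.
move=> t0 ts s0 U1; have [/andP[d0 d1] dE] := fine_diam_bounds _ U1.
have [d_eq0|dn0] := eqVneq (fine (diam U)) 0.
  by rewrite d_eq0 powR0 ?gt_eqF // diam_pow_ge0.
rewrite /diam_pow; case: eqP => [U0|_]; last first.
  rewrite dE poweR_EFin lee_fin; apply: ger_powR => //.
  by rewrite d1 andbT lt_neqAle eq_sym dn0 d0.
have : diam U = 0%E.
  apply/eqP; rewrite eq_le diam_ge0 andbT; apply: diam_le => // x y.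
  by rewrite U0.
by move=> h; rewrite h eqxx in dn0.
Qed.

Lemma hausdorff_measure_eq0 s E :
  (forall e d, 0 < e -> 0 < d -> exists F : (set V)^nat,
     [/\ E `<=` \bigcup_i F i, forall i, (diam (F i) <= e%:E)%E &
         (\sum_(0 <= i <oo) diam_pow s (F i) <= d%:E)%E]) ->
  hausdorff_measure s E = 0%E.
Proof.
move=> h; have pre0 e : (0 <= hausdorff_premeasure s e E)%E.
  by apply: le_ereal_inf_tmp => _ [F _ <-]; apply: nneseries_ge0 => *; exact: diam_pow_ge0.
apply/eqP; rewrite eq_le; apply/andP; split; last first.
  apply: le_trans (pre0 1) _; apply: ereal_sup_ubound; exists 1 => //=.
apply: ge_ereal_sup => _ [e /= e0 <-].
apply/lee_addgt0Pr => d d0; rewrite add0e.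
have [F [EF Fe Fd]] := h e d e0 d0; apply: le_trans Fd.
by apply: ereal_inf_lbound; exists F.
Qed.

Lemma hausdorff_measure_eq0_cover s E e d : hausdorff_measure s E = 0%E ->
  0 < e -> 0 < d -> exists F : (set V)^nat,
     [/\ E `<=` \bigcup_i F i, forall i, (diam (F i) <= e%:E)%E &
         (\sum_(0 <= i <oo) diam_pow s (F i) < d%:E)%E].
Proof.
move=> H0 e0 d0; have : (hausdorff_premeasure s e E < d%:E)%E.
  apply: (@le_lt_trans _ _ 0%E); last by rewrite lte_fin.
  by rewrite -H0; apply: ereal_sup_ubound; exists e.
by move/ereal_inf_lt => [_ [F [EF Fe] <-] Fd]; exists F.
Qed.

(** Cover the [i]-th set with total [d / 2 ^ (i + 1)] and enumerate the pairs of
    indices. *)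
Lemma hausdorff_measure_bigcup_eq0 s (E : nat -> set V) :
  (forall i, hausdorff_measure s (E i) = 0%E) ->
  hausdorff_measure s (\bigcup_i E i) = 0%E.
Proof.
move=> E0; apply: hausdorff_measure_eq0 => e d e0 d0.
have hF i : exists F : (set V)^nat,
    [/\ E i `<=` \bigcup_j F j, forall j, (diam (F j) <= e%:E)%E &
        (\sum_(0 <= j <oo) diam_pow s (F j) < (d / (2 ^ i.+1)%:R)%:E)%E].
  by apply: hausdorff_measure_eq0_cover => //; rewrite divr_gt0 // ltr0n expn_gt0.
have [G hG] := choice hF.
have /card_esym/ppcard_eqP[f] := card_nat2.
exists (fun k => G (f k).1 (f k).2); split.
- move=> x [i _ /(let: And3 h _ _ := hG i in h) [j _ Gx]].
  have fK : f (f^-1%FUN (i, j)) = (i, j) by rewrite invK // in_setT.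
  by exists (f^-1%FUN (i, j)) => //=; rewrite fK.
- by move=> k; have [_ h _] := hG (f k).1; exact: h.
rewrite nneseries_esumT; last by move=> *; exact: diam_pow_ge0.
rewrite -(reindex_esum setT setT f (fun p => diam_pow s (G p.1 p.2))); last exact: bij.
have -> : [set: nat * nat] = [set: nat] `*`` (fun=> [set: nat]).
  by apply/seteqP; split.
rewrite -(@esum_esum R nat nat setT (fun=> setT) (fun i j => diam_pow s (G i j))); last first.
  by move=> *; exact: diam_pow_ge0.
apply: (@le_trans _ _ (\sum_(0 <= i <oo) (d / (2 ^ i.+1)%:R)%:E)%E); last first.
  by apply: epsilon_trick0; exact: ltW.
rewrite -nneseries_esumT; last first.
  by move=> i; apply: esum_ge0 => *; exact: diam_pow_ge0.
apply: lee_nneseries => [i _ _|i _].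
  by apply: esum_ge0 => *; exact: diam_pow_ge0.
rewrite -nneseries_esumT; last by move=> *; exact: diam_pow_ge0.
by have [_ _ /ltW] := hG i.
Qed.

Lemma hausdorff_measure_subset_eq0 s E E' : E `<=` E' ->
  hausdorff_measure s E' = 0%E -> hausdorff_measure s E = 0%E.
Proof.
move=> EE' H0; apply: hausdorff_measure_eq0 => e d e0 d0.
have [F [EF Fe Fd]] := hausdorff_measure_eq0_cover _ _ _ _ H0 e0 d0.
by exists F; split => //; [exact: subset_trans EF | exact: ltW].
Qed.

(** The convergence half of the Borel--Cantelli lemma: cover by the balls with
    index at least [N] and bound the tail of the series by telescoping. *)
Lemma hausdorff_measure_limsup_eq0 (c : nat -> V) (w s : R) : 0 < w -> 0 < s -> 1 < w * s ->
  hausdorff_measure s [set x | forall N, exists2 q, (N <= q)%N &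
     `|c q - x| <= q.+1%:R `^ (- w)] = 0%E.
Proof.
move=> w0 s0 ws; pose b := w * s - 1; have b0 : 0 < b by rewrite /b; lra.
apply: hausdorff_measure_eq0 => e d e0 d0.
have [X1 X1_0 hX1] := powR_large w (2 / e) w0.
have [X2 X2_0 hX2] := powR_large b (2 `^ s / b / d) b0.
pose N := (Num.truncn (X1 + X2)).+1; have NX : X1 + X2 < N%:R := truncnS_gt _.
have N0 : 0 < N%:R :> R by [].
pose r i : R := i.+1%:R `^ (- w).
have r0 i : 0 < r i by exact: powR_gt0.
pose F i : set V := if (N <= i)%N then [set x | `|c i - x| <= r i] else set0.
have Fdiam i : (diam (F i) <= (2 * r i)%:E)%E.
  apply: diam_le; first by rewrite mulr_ge0 // ltW.
  move=> x y; rewrite /F; case: ifP => //= _ h1 h2.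
  by apply: le_trans (ler_distD (c i) _ _) _; rewrite (distrC x); lra.
exists F; split.
- move=> x /(_ N)[q Nq h]; exists q => //; by rewrite /F Nq.
- move=> i; have [Ni|iN] := leqP N i; last first.
    have -> : F i = set0 by rewrite /F leqNgt iN.
    by apply: diam_le => //; exact: ltW.
  apply: le_trans (Fdiam i) _; rewrite lee_fin /r powRN ler_pdivrMr ?powR_gt0 //.
  rewrite mulrC -ler_pdivrMr //; apply: hX1.
  have : N%:R <= i.+1%:R :> R by rewrite ler_nat leqW.
  lra.
pose K := 2 `^ s / b; have K0 : 0 < K by rewrite divr_gt0 // powR_gt0.
have term i : (N <= i)%N -> (diam_pow s (F i) <= (K * i%:R `^ (- b) - K * i.+1%:R `^ (- b))%:E)%E.
  move=> Ni; apply: le_trans (diam_pow_le _ _ _ (ltW s0) (Fdiam i)) _.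
  rewrite lee_fin powRM // ?(ltW (r0 i)) // /r -powRrM -mulrBr.
  have i0 : (0 < i)%N by apply: leq_trans Ni.
  have := powR_telescope b i b0 i0.
  have -> : - (1 + b) = - w * s by rewrite /b; ring.
  move=> h; rewrite /K -mulrA ler_wpM2l ?powR_ge0 // ler_pdivlMl //.
have part m : (\sum_(0 <= i < N + m) diam_pow s (F i) <=
    (K * N%:R `^ (- b) - K * (N + m)%:R `^ (- b))%:E)%E.
  elim: m => [|m ih].
    rewrite addn0 subrr big_nat big1 // => i /andP[_ iN].
    by rewrite /F leqNgt iN diam_pow_set0.
  rewrite addnS big_nat_recr //=.
  apply: le_trans (leeD ih (term _ (leq_addr _ _))) _.
  by rewrite -EFinD lee_fin; lra.
apply: (@le_trans _ _ (K * N%:R `^ (- b))%:E); last first.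
  rewrite lee_fin powRN ler_pdivrMr ?powR_gt0 // mulrC -ler_pdivrMr //.
  by apply: hX2; lra.
apply: lime_le; first by apply: is_cvg_nneseries => *; exact: diam_pow_ge0.
exists N => // m /= Nm; rewrite -(subnKC Nm); apply: le_trans (part _) _.
by rewrite lee_fin gerBl mulr_ge0 ?powR_ge0 // ltW.
Qed.

End HausdorffNull.

(** * The upper bound *)

Lemma infinite_intP (S : set int) :
  infinite_set S <-> forall N : nat, exists2 q, S q & (N <= `|q|)%N.
Proof.
split => [Sinf N|unbounded /finite_fsetP[X SX]].
  apply: contrapT => h; apply: Sinf.
  apply: (@sub_finite_set _ _ ((fun i : nat => i%:Z - N%:Z) @` `I_(N + N))).
    move=> q Sq; have qN : (`|q| < N)%N.
      by rewrite ltnNge; apply/negP => Nq; apply: h; exists q.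
    by exists (absz (q + N%:Z)) => /=; lia.
  exact/finite_image/finite_II.
have [q Sq] := unbounded (\max_(x <- enum_fset X) `|x|).+1.
have qX : q \in X by move: Sq; rewrite SX.
by rewrite (big_rem q) //= leqNgt ltnS leq_maxl.
Qed.

Section ApproximableSet.
Context {R : realType} {n : nat} (A : 'cV[R]_n).

Lemma unif_exponent_lt w : (unif_exponent A < w%:E)%E -> scales_without_return A w.
Proof.
move=> Aw X; apply: contrapT => h.
suff : (w%:E <= unif_exponent A)%E by rewrite leNgt Aw.
apply: ereal_sup_ubound; exists w => //=; exists X; split; first exact: num_real.
move=> Q XQ; apply: contrapT => hQ; apply: h; exists Q; first exact: ltW.
move=> k k0 kQ; rewrite ltNge; apply/negP => hk; apply: hQ; exists k%:Z; split => //.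
- by rewrite eqz_nat -lt0n.
- by rewrite -pmulrn normr_nat.
Qed.

(** Dirichlet: with [L] about [Q ^ w], some multiple of index at most [L ^ n] is
    within [1 / L] of an integer point. The value [w = 1 / (2 (n + 1))] keeps
    [w * n] away from 1, so that [L ^ n <= (2 Q ^ w) ^ n <= Q] for large [Q]. *)
Lemma unif_exponent_gt0 : (0 < unif_exponent A)%E.
Proof.
pose w : R := (2 * n.+1%:R)^-1.
have n1 : 0 < n.+1%:R :> R by [].
have w0 : 0 < w by rewrite invr_gt0; lra.
suff : (w%:E <= unif_exponent A)%E by apply: lt_le_trans; rewrite lte_fin.
have wn : 0 < 1 - w * n%:R.
  have nn : w * n.+1%:R = 2^-1 by rewrite /w invfM -mulrA mulVf ?mulr1 ?gt_eqF.
  by move: nn; rewrite -natr1; lra.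
have [X X0 hX] := powR_large (1 - w * n%:R) (2 ^+ n) wn.
apply: ereal_sup_ubound; exists w => //=; exists (X + 1); split; first exact: num_real.
move=> Q XQ; have Q1 : 1 <= Q by lra.
pose L := (Num.truncn (Q `^ w)).+1.
have [k [k0 kL hk]] := dirichlet A L (ltn0Sn _).
have Qw1 : 1 <= Q `^ w by apply: powR_ge1 => //; exact: ltW.
have Q0 : 0 < Q by lra.
exists k%:Z; split.
- by rewrite eqz_nat -lt0n.
- rewrite -pmulrn normr_nat.
  apply: (@le_trans _ _ ((2 * Q `^ w) ^+ n)).
    apply: (@le_trans _ _ (L ^ n)%N%:R); first by rewrite ler_nat.
    rewrite natrX; apply: lerXn2r; rewrite ?nnegrE //; first by lra.
    have /andP[] := truncn_itv (le_trans ler01 Qw1); rewrite /L -natr1; lra.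
  rewrite exprMn -[(Q `^ w) ^+ n]powR_mulrn ?powR_ge0 // -powRrM.
  have h := hX Q (ltac:(lra)).
  apply: le_trans (ler_wpM2r (powR_ge0 _ _) h) _.
  by rewrite -powRD ?(gt_eqF Q0) ?implybT // subrK powRr1 // ltW.
- apply: le_trans hk _; rewrite powRN lef_pV2 ?posrE ?powR_gt0 //.
  by rewrite ltW // truncnS_gt.
Qed.

Lemma approx_setP (v w : R) beta : w < v -> approx_set A v beta ->
  forall N : nat, exists q : int, [/\ q != 0, (N <= `|q|)%N &
    dist_int (q%:~R *: A - beta) <= `|q%:~R : R| `^ (- w)].
Proof.
move=> wv beta_v N.
have : (w%:E < inhom_exponent A beta)%E by apply: lt_le_trans beta_v; rewrite lte_fin.
move=> /ereal_sup_gt[_ [w' /= /infinite_intP w'inf <-]].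
rewrite lte_fin => ww'; have [q [q0 hq] Nq] := w'inf N.
exists q; split => //; apply: le_trans hq _; apply: ler_powR; last by rewrite lerN2 ltW.
by rewrite -intr_norm -[1]/(1%:~R) ler_int; lia.
Qed.

(** Indices are positive integers [q.+1] with a sign [b], so that each limsup set
    runs over the natural numbers. *)
Definition int_shift (p : 'cV[int]_n) (b : bool) (q : nat) : 'cV[R]_n :=
  residue ((if b then q.+1%:R else - q.+1%:R) *: A) - int_vec p.

(** The integer point nearest to [q A - beta] varies with [q], but once [q A] is
    reduced modulo 1 it stays in a bounded box. So one integer point [p] and one
    sign of [q] occur infinitely often, and there are countably many choices of
    both: the set lies in a countable union of limsup sets of balls. *)
Lemma approx_set_cover (v w : R) : 0 < w -> w < v ->
  approx_set A v `<=` \bigcup_k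
    (if @choice.unpickle ('cV[int]_n * bool)%type k is Some pb then
       [set x | forall N, exists2 q, (N <= q)%N &
          `|int_shift pb.1 pb.2 q - x| <= q.+1%:R `^ (- w)]
     else set0).
Proof.
move=> w0 wv beta beta_v.
suff [p [b hpb]] : exists p b, forall N, exists2 q, (N <= q)%N &
          `|int_shift p b q - beta| <= q.+1%:R `^ (- w).
  by exists (choice.pickle (p, b)) => //; rewrite choice.pickleK.
apply: contrapT => /forallNP h.
pose M := (Num.truncn (2 + `|beta|)).+1.
pose box := ({ffun 'I_n -> 'I_(2 * M).+1} * bool)%type.
pose pt (f : {ffun 'I_n -> 'I_(2 * M).+1}) : 'cV[int]_n := \col_i ((f i)%:Z - M%:Z).
have hN (x : box) : exists N, forall q, (N <= q)%N ->
    ~ `|int_shift (pt x.1) x.2 q - beta| <= q.+1%:R `^ (- w).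
  have /forallNP/(_ x.2) /existsNP[N hN] := h (pt x.1).
  by exists N => q Nq hq; apply: hN; exists q.
have [g hg] := choice hN.
have [q [q0 Nq hq]] := approx_setP _ _ _ wv beta_v (\max_x g x).+1.
pose b := (0 < q); pose m := (`|q|).-1.
have qE : q%:~R = (if b then m.+1%:R else - m.+1%:R) :> R.
  rewrite /b /m prednK; last by rewrite absz_gt0.
  have {1}-> : q = if 0 < q then (absz q)%:Z else - (absz q)%:Z by case: ifP; lia.
  by case: ifP => _; rewrite ?rmorphN /= -pmulrn.
pose u := residue (q%:~R *: A) - beta.
have hu : `|residue u| <= m.+1%:R `^ (- w).
  have -> : `|residue u| = dist_int (q%:~R *: A - beta).
    rewrite norm_residue /u /residue addrAC -int_vecN dist_int_shift //.
  apply: le_trans hq _; rewrite -intr_norm.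
  have -> // : `|q|%:~R = m.+1%:R :> R.
  by rewrite /m prednK ?absz_gt0.
have p_le : `|int_vec (nearest u) : 'cV[R]_n| <= 2 + `|beta|.
  have -> : int_vec (nearest u) = residue (q%:~R *: A) - beta - residue u.
    by rewrite /residue -/u opprB addrC subrK.
  apply: le_trans (ler_normB _ _) _; rewrite norm_residue.
  apply: le_trans (lerD (ler_normB _ _) (dist_int_le1 _)) _.
  rewrite norm_residue; have := dist_int_le1 (q%:~R *: A); lra.
have pM i : (- M%:Z <= nearest u i ord0 <= M%:Z).
  have /(mx_norm_lub _ (le_trans (normr_ge0 _) p_le)) /(_ i ord0) := p_le.
  rewrite !mxE -intr_norm => h1; have h2 := truncnS_gt (2 + `|beta|).
  by have := le_lt_trans h1 h2; rewrite -/M -[M%:R]/(M%:Z%:~R) ltr_int; lia.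
pose f : {ffun 'I_n -> 'I_(2 * M).+1} := [ffun i => inord `|nearest u i ord0 + M%:Z|].
have fp : pt f = nearest u.
  apply/matrixP => i j; have -> : j = ord0 by exact: ord1.
  have := pM i; rewrite mxE ffunE; move: (nearest u i ord0) => z zM.
  by rewrite inordK; lia.
apply: (hg (f, b) m).
  have : (g (f, b) <= \max_x g x)%N by apply: leq_bigmax.
  by rewrite /m; lia.
rewrite /= /int_shift fp -qE.
have -> : residue (q%:~R *: A) - int_vec (nearest u) - beta = residue u.
  by rewrite addrAC.
exact: hu.
Qed.

Lemma hausdorff_measure_approx_set_eq0 (v s : R) : 0 < v -> 1 < v * s ->
  hausdorff_measure s (approx_set A v) = 0%E.
Proof.
move=> v0 vs; have s0 : 0 < s by rewrite -(pmulr_rgt0 _ v0); lra.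
have sv : s^-1 < v by rewrite -[ltLHS]mul1r ltr_pdivrMr.
pose w := (v + s^-1) / 2.
have is0 : 0 < s^-1 by rewrite invr_gt0.
have w0 : 0 < w by rewrite /w; lra.
have wv : w < v by rewrite /w; lra.
have ws : 1 < w * s by rewrite -ltr_pdivrMr // mul1r /w; lra.
apply: hausdorff_measure_subset_eq0 (approx_set_cover _ _ w0 wv) _.
apply: hausdorff_measure_bigcup_eq0 => k; case: choice.unpickle => [pb|].
  exact: hausdorff_measure_limsup_eq0.
apply: hausdorff_measure_eq0 => e d e0 d0; exists (fun=> set0); split => //.
- by move=> i; apply: diam_le => //; exact: ltW.
- rewrite eseries0 ?lee_fin ?ltW // => i _ _; exact: diam_pow_set0.
Qed.

End ApproximableSet.

(** * The lower bound *)

(** Transposition is an isometry onto row vectors, for which bounded closed sets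
    are known to be compact. *)
Lemma compact_cV_balls {R : realType} {n : nat} (r : R) :
  compact [set x : 'cV[R]_n | `|x| <= r].
Proof.
have [r0|r0] := ltP r 0.
  have -> : [set x : 'cV[R]_n | `|x| <= r] = set0.
    by apply/seteqP; split => // x /= /(le_trans (normr_ge0 x)); rewrite leNgt r0.
  exact: compact0.
have norm_tr m k (x : 'M[R]_(m, k)) : `|x^T| = `|x|.
  have le m' k' (y : 'M[R]_(m', k')) : `|y^T| <= `|y|.
    apply/mx_norm_lub => // i j; rewrite mxE.
    by have /(mx_norm_lub _ (normr_ge0 _)) := lexx `|y|.
  by apply/eqP; rewrite eq_le le -{1}(trmxK x) le.
have -> : [set x : 'cV[R]_n | `|x| <= r] = trmx @` [set x : 'rV[R]_n | `|x| <= r].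
  apply/seteqP; split => [x xr|_ [x xr <-]] /=; last by rewrite norm_tr.
  by exists x^T; rewrite ?trmxK //= norm_tr.
apply: continuous_compact; last first.
  apply: bounded_closed_compact.
    by exists r; split; [exact: num_real | move=> M rM x /= xr; apply: le_trans xr (ltW rM)].
  have := @closed_closed_ball_ R 'rV[R]_n 0 r; congr closed.
  by apply/seteqP; split => x /=; rewrite /closed_ball_ /= sub0r normrN.
apply: continuous_subspaceT => x B /nbhs_ballP[e /= e0 eB]; apply/nbhs_ballP.
exists e => // y xy; apply: eB; move: xy.
by rewrite -!ball_normE /= -linearB norm_tr.
Qed.

Section HausdorffLower.
Context {R : realType} {V : normedModType R} (Y : nat -> seq V) (rad : nat -> R).
Hypothesis rad_gt0 : forall j, 0 < rad j.
Hypothesis radS : forall j, rad j.+1 <= rad j / 4.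
Hypothesis Y_size : forall j, (0 < size (Y j))%N.
Hypothesis Y_rad : forall j y, y \in Y j -> `|y| <= rad j.
Hypothesis compact_balls : forall r, compact [set x : V | `|x| <= r].

(** A cover of small content would, after replacing each member of diameter
    [d i] by a ball of radius [2 * max (d i) (th i)], contradict the mass
    distribution bound. The positive numbers [th i] serve members of diameter 0;
    their [s]-th powers [eps i] have a small sum. *)
Lemma hausdorff_measure_sum_set_neq0 (s t D : R) (E : set V) :
  0 < D -> 0 <= t -> t <= s -> 0 < s ->
  (forall k x u, rad k <= u -> near_count Y k x u <= D * u `^ s * total Y k) ->
  sum_set Y rad `<=` E -> hausdorff_measure t E <> 0%E.
Proof.
move=> D0 t0 ts s0 frost KE H0.
pose k0 := (D * 3 `^ s)^-1; have k0_gt0 : 0 < k0 by rewrite invr_gt0 mulr_gt0 // powR_gt0.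
have two_s : 0 < 2 `^ s :> R by exact: powR_gt0.
pose k1 := k0 / 2 `^ s / 2; have k1_gt0 : 0 < k1 by rewrite !divr_gt0.
have [F [EF F1 Fk]] := hausdorff_measure_eq0_cover _ _ _ _ H0 ltr01 k1_gt0.
pose d i := fine (diam (F i)).
pose eps i : R := k1 / (2 ^ i.+1)%:R.
have eps0 i : 0 < eps i by rewrite divr_gt0 // ltr0n expn_gt0.
pose th i := eps i `^ s^-1; have th0 i : 0 < th i by exact: powR_gt0.
have d0 i : 0 <= d i by have [/andP[]] := fine_diam_bounds _ (F1 i).
pose rho i := 2 * Num.max (d i) (th i).
have rho0 i : 0 < rho i by rewrite mulr_gt0 // lt_max th0 orbT.
pose z i : V := xget 0 (F i).
have cov x : sum_set Y rad x -> exists i, `|z i - x| < rho i.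
  move=> /KE/EF[i _ Fx]; exists i.
  have Fz : F i (z i) by apply: (xgetPex 0); exists x.
  have [_ dE] := fine_diam_bounds _ (F1 i).
  have := diam_ge _ _ _ Fz Fx; rewrite dE lee_fin -/(d i) => h.
  have : d i <= Num.max (d i) (th i) by rewrite le_max lexx.
  have : 0 < Num.max (d i) (th i) by rewrite lt_max th0 orbT.
  by rewrite /rho; lra.
have [N hN] := sum_set_content Y rad rad_gt0 radS Y_size Y_rad compact_balls
  s D z rho D0 (ltW s0) frost rho0 cov.
have rho_s i : rho i `^ s <= 2 `^ s * (d i `^ s + eps i).
  rewrite powRM //; last by rewrite le_max d0.
  rewrite ler_pM2l //; have thE : th i `^ s = eps i.
    by rewrite /th -powRrM mulVf ?gt_eqF // powRr1 // ltW.
  rewrite /Num.max; case: ifP => _; first by rewrite thE lerDr powR_ge0.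
  by rewrite lerDl ltW.
have sumd : \sum_(0 <= i < N) d i `^ s < k1.
  rewrite -lte_fin -sumEFin; apply: le_lt_trans Fk.
  apply: le_trans (nneseries_lim_ge N _); last by move=> *; exact: diam_pow_ge0.
  by apply: lee_sum => i _; exact: fine_diam_pow_le.
have sume : \sum_(0 <= i < N) eps i <= k1.
  rewrite -lee_fin -sumEFin.
  apply: le_trans (epsilon_trick0 (fun=> true) (ltW k1_gt0)).
  by apply: (nneseries_lim_ge N) => i _ _; rewrite lee_fin ltW.
have : k0 <= 2 `^ s * (\sum_(0 <= i < N) d i `^ s + \sum_(0 <= i < N) eps i).
  apply: le_trans hN _; rewrite -big_split mulr_sumr; apply: ler_sum => i _.
  exact: rho_s.
apply/negP; rewrite -ltNge.
apply: (@lt_le_trans _ _ (2 `^ s * (k1 + k1))); first by rewrite ltr_pM2l //; lra.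
by rewrite /k1 -splitr mulrC divfK // gt_eqF.
Qed.

End HausdorffLower.

Section LowerBound.
Context {R : realType} {n : nat} (A : 'cV[R]_n) (v : R).
Hypothesis v_gt0 : 0 < v.

Lemma next_radius_small e : 0 < e -> exists N, forall Q, (N <= Q)%N -> next_radius v Q <= e.
Proof.
move=> e0; have [X X0 hX] := powR_large v e^-1 v_gt0.
exists (Num.truncn X).+1 => Q XQ.
have : X <= 2 * Q%:R.
  have := truncnS_gt X; have : (Num.truncn X).+1%:R <= Q%:R :> R by rewrite ler_nat.
  by have : 0 <= Q%:R :> R by []; lra.
move/hX => h; have p0 : 0 < (2 * Q%:R) `^ v by apply: lt_le_trans h; rewrite invr_gt0.
have : ((2 * Q%:R) `^ v)^-1 <= e by rewrite -(invrK e) lef_pV2 ?posrE ?invr_gt0.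
rewrite /next_radius powRN; have : 0 < ((2 * Q%:R) `^ v)^-1 by rewrite invr_gt0.
lra.
Qed.

(** Inductive choice of the scales: from the radius [rad j] the regular
    distribution of return times yields arbitrarily large [Q j], which determines
    the next radius. Taking [Q j] large makes the radii decrease as fast as
    needed. *)
Lemma cantor_scales (s s1 : R) : 0 < s -> s < s1 -> s1 * v < 1 ->
  (forall w, v < w -> scales_without_return A w) ->
  exists (Q : nat -> nat) (rad : nat -> R),
  [/\ forall j, 0 < rad j,
      forall j, rad j.+1 = next_radius v (Q j),
      forall j, rad j.+1 <= rad j / 4,
      forall j, (2 * Q j <= Q j.+1)%N &
   [/\ forall j, (0 < size (steps A (rad j) (Q j)))%N,
      forall j, 2 * 64 `^ s1 * (4 * (rad j.+1 / rad j)) `^ s1 <= (rad j.+1 / rad j) `^ s &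
      forall j y u, rad j.+1 <= u ->
       (count (fun z => `|z - y| <= u)%R (steps A (rad j) (Q j)))%:R <=
         2 * 64 `^ s1 * (u / rad j) `^ s1 * (size (steps A (rad j) (Q j)))%:R]].
Proof.
move=> s0 ss1 s1v sparse; have s1_gt0 : 0 < s1 by lra.
have s1s : 0 < s1 - s by lra.
pose w := (v + s1^-1) / 2.
have v_s1 : v < s1^-1 by rewrite -[ltRHS]mul1r ltr_pdivlMr // mulrC.
have vw : v < w by rewrite /w; lra.
have w0 : 0 < w := lt_trans v_gt0 vw.
have s1w : s1 * w < 1.
  have : s1 * w < s1 * s1^-1 by rewrite ltr_pM2l // /w; lra.
  by rewrite divff // gt_eqF.
have [X X0 hX] := powR_large (s1 - s) (2 * 64 `^ s1 * 4 `^ s1) s1s.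
(* Lam >= 4 is for the decrease of the radii, Lam >= X for the gap between
   the exponents *)
pose Lam := X + 4; have Lam0 : 0 < Lam by rewrite /Lam; lra.
have step (st : R * nat) : exists Q : nat, 0 < st.1 <= 4^-1 ->
    [/\ (2 * st.2 <= Q)%N, 0 < next_radius v Q, next_radius v Q <= st.1 / Lam,
       (0 < size (steps A st.1 Q))%N &
       forall y u, next_radius v Q <= u ->
         (count (fun z => `|z - y| <= u)%R (steps A st.1 Q))%:R <=
         2 * 64 `^ s1 * (u / st.1) `^ s1 * (size (steps A st.1 Q))%:R].
  have [/andP[r0 r4]|] := boolP (0 < st.1 <= 4^-1); last by exists 0%N.
  have rL : 0 < st.1 / Lam by rewrite divr_gt0.
  have [N hN] := next_radius_small _ rL.
  have [Q [NQ szQ hQ]] :=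
    steps_regular A v s1 w v_gt0 s1_gt0 s1v w0 s1w (sparse _ vw) st.1 (2 * st.2 + N).+1 r0 r4.
  exists Q => _; split.
  - exact: leq_trans (leq_addr _ _) (ltnW NQ).
  - exact: next_radius_gt0 (leq_ltn_trans (leq0n _) NQ).
  - exact: hN (leq_trans (leq_addl _ _) (ltnW NQ)).
  - exact: szQ.
  - exact: hQ.
have [g hg] := choice step.
pose st := fix st k : R * nat :=
  if k is k'.+1 then (next_radius v (g (st k')), g (st k')) else (4^-1, 0%N).
have st_ok k : 0 < (st k).1 <= 4^-1.
  elim: k => [|k ih]; first by rewrite /= lexx andbT invr_gt0.
  have [_ r0 rL _ _] := hg _ ih; rewrite /= r0 /=.
  apply: le_trans rL _; have /andP[a0 a4] := ih.
  rewrite ler_pdivrMr //; apply: le_trans a4 _.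
  by rewrite ler_peMr ?invr_ge0 // /Lam; lra.
pose rad k := (st k).1; pose Q k := g (st k).
have r0 j : 0 < rad j by have /andP[] := st_ok j.
have rL j : rad j.+1 <= rad j / Lam by have [_ _ h _ _] := hg _ (st_ok j).
exists Q, rad; split => //.
- move=> j; apply: le_trans (rL j) _; rewrite ler_pM2l // lef_pV2 ?posrE // /Lam; lra.
- by move=> j; have [h _ _ _ _] := hg _ (st_ok j.+1).
split.
- by move=> j; have [_ _ _ h _] := hg _ (st_ok j).
- move=> j; pose x := rad j.+1 / rad j; rewrite -/x.
  have x0 : 0 < x by rewrite divr_gt0.
  have xX : X <= x^-1.
    rewrite /x invf_div ler_pdivlMr //; have := rL j; rewrite ler_pdivlMr //.
    have := r0 j.+1; rewrite /Lam; nra.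
  have := hX _ xX; have -> : x^-1 `^ (s1 - s) = x `^ s / x `^ s1.
    rewrite -powR_inv1 ?ltW // -powRrM mulN1r opprB powRD; last first.
      by rewrite (gt_eqF x0) implybT.
    by rewrite powRN.
  rewrite ler_pdivlMr ?powR_gt0 //; apply: le_trans.
  by rewrite powRM ?(ltW x0) // mulrA.
- by move=> j y u; have [_ _ _ _ h] := hg _ (st_ok j); exact: h.
Qed.

(** A sum of residues of multiples of [A] is a multiple of [A] up to an integer
    point. As [Q] at least doubles at each level, the sum of the indices is at
    most twice the last bound, and it is at least the number of terms since the
    terms are positive. *)
Lemma partial_sums_orbit (Q : nat -> nat) (rad : nat -> R) :
  (forall j, 2 * Q j <= Q j.+1)%N ->
  forall k c, c \in partial_sums (fun j => steps A (rad j) (Q j)) k.+1 ->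
  exists q p, [/\ c = q%:R *: A - int_vec p, (k < q)%N & (q <= 2 * Q k)%N].
Proof.
move=> QQ k c.
pose Qprev j := if j is j'.+1 then Q j' else 0%N.
suff gen j c' : c' \in partial_sums (fun j => steps A (rad j) (Q j)) j ->
    exists q p, [/\ c' = q%:R *: A - int_vec p, (j <= q)%N & (q <= 2 * Qprev j)%N].
  by move=> /gen[q [p [-> ? ?]]]; exists q, p.
elim: j c' => [|j ih] c'.
  rewrite inE => /eqP ->; exists 0%N, 0; split => //.
  by apply/matrixP => i i'; rewrite !mxE mul0r subr0.
move=> /allpairsP[[x y] /= [/ih[q [p [-> jq qQ]]] /stepsP[_ [t [t0 tQ ->]]] ->]].
exists (q + t)%N, (p + nearest (t%:R *: A)); split.
- by rewrite natrD scalerDl int_vecD /residue opprD addrACA.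
- by rewrite -addn1 leq_add.
- case: j {ih} jq qQ tQ => [|j] jq qQ tQ /=; first by move: qQ tQ; rewrite /= ; lia.
  by have := QQ j; move: qQ => /=; lia.
Qed.

Lemma sum_set_approx (Q : nat -> nat) (rad : nat -> R) :
  (forall j, rad j.+1 = next_radius v (Q j)) ->
  (forall j, 2 * Q j <= Q j.+1)%N ->
  sum_set (fun j => steps A (rad j) (Q j)) rad `<=` approx_set A v.
Proof.
move=> radQ QQ x Kx; apply: ereal_sup_ubound; exists v => //=.
apply/infinite_intP => N; have [c cS xc] := Kx N.+1.
have [q [p [cE Nq qQ]]] := partial_sums_orbit Q rad QQ N c cS.
have q0 : (0 < q)%N by lia.
exists q%:Z; last by rewrite /= ltnW.
split; first by rewrite eqz_nat -lt0n.
rewrite -pmulrn normr_nat.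
have -> : q%:R *: A - x = c - x + int_vec p by rewrite cE addrAC subrK.
rewrite dist_int_shift; apply: le_trans (dist_int_le_norm _) _.
rewrite distrC; apply: le_trans xc _; rewrite radQ /next_radius mulrCA divff ?mulr1 //.
rewrite !powRN lef_pV2 ?posrE ?powR_gt0 ?ltr0n //; last first.
  by rewrite mulr_gt0 // ltr0n; lia.
rewrite ge0_ler_powR ?nnegrE ?(ltW v_gt0) //.
by rewrite -natrM ler_nat.
Qed.

(** The exponents [t < s < s1 < 1 / v] are used as follows: [s1] for the
    distribution of return times, [s] for the mass distribution on the Cantor
    set, where [s > 0] even if [t = 0]. *)
Lemma hausdorff_measure_approx_set_neq0 t : 0 <= t -> t * v < 1 ->
  (forall w, v < w -> scales_without_return A w) ->
  hausdorff_measure t (approx_set A v) <> 0%E.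
Proof.
move=> t0 tv sparse.
have iv0 : 0 < v^-1 by rewrite invr_gt0.
have tv' : t < v^-1 by rewrite -[ltRHS]mul1r ltr_pdivlMr.
pose s := (2 * t + v^-1) / 3; pose s1 := (t + 2 * v^-1) / 3.
have s0 : 0 < s by rewrite /s; lra.
have ss1 : s < s1 by rewrite /s /s1; lra.
have s1v : s1 * v < 1 by rewrite -ltr_pdivlMr // mul1r /s1; lra.
have [Q [rad [r0 radQ radS QQ [Ysz gap Ycnt]]]] := cantor_scales s s1 s0 ss1 s1v sparse.
pose Y j := steps A (rad j) (Q j).
have Yrad j y : y \in Y j -> `|y| <= rad j by move=> /stepsP[].
have C1 : 1 <= 2 * 64 `^ s1 :> R.
  by have : 1 <= 64 `^ s1 :> R by [apply: powR_ge1; lra]; lra.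
pose C : R := 2 * 64 `^ s1.
apply: (hausdorff_measure_sum_set_neq0 Y rad r0 radS Ysz Yrad compact_cV_balls s t
  (frostman_const rad s s1 C)) => //.
- exact: (frostman_const_gt0 rad r0).
- by rewrite /s; lra.
- exact: (near_count_frostman Y rad r0 radS Ysz Yrad s s1 C (ltW s0) (ltW ss1) C1 gap Ycnt).
- exact: sum_set_approx.
Qed.

End LowerBound.

Theorem theorem5 (R : realType) (n : nat) (hn : (1 <= n)%N) (A : 'cV[R]_n)
  (hA : rat_independent_with1 A) (v : R) (hv : (unif_exponent A <= v%:E)%E) :
  hausdorff_dim (approx_set A v) = (v^-1)%:E.
Proof.
have v0 : 0 < v by rewrite -lte_fin; apply: lt_le_trans hv; exact: unif_exponent_gt0.
have sparse w : v < w -> scales_without_return A w.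
  by move=> vw; apply: unif_exponent_lt; apply: le_lt_trans hv _; rewrite lte_fin.
apply/eqP; rewrite eq_le; apply/andP; split.
  apply/lee_addgt0Pr => e e0; rewrite -EFinD; apply: ereal_inf_lbound.
  have iv0 : 0 < v^-1 by rewrite invr_gt0.
  exists (v^-1 + e) => //=; split; first by lra.
  apply: hausdorff_measure_approx_set_eq0 => //.
  by rewrite mulrDr divff ?gt_eqF // ltrDl mulr_gt0.
apply: le_ereal_inf_tmp => _ [t /= [t0 Ht] <-]; rewrite lee_fin leNgt; apply/negP => tv.
apply: (hausdorff_measure_approx_set_neq0 A v v0 t t0 _ sparse Ht).
by rewrite -ltr_pdivlMr // mul1r.
Qed.
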